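(* Let $\mathbf{k}$ be a field of characteristic $p>0$ (see context) and let $(\mathfrak g,[-,-],\rhd)$ be a post-Lie algebra over $\mathbf{k}$. Let $\mathfrak g^{(p)}=\mathrm{span}_{\mathbf k}\{x^{p^k}\in \mathrm U(\mathfrak g)\mid x\in\mathfrak g,\ k\ge 0\}$ be the Lie algebra of primitive elements of the universal enveloping algebra $\mathrm U(\mathfrak g)$ of $(\mathfrak g,[-,-])$, with bracket the commutator of $\mathrm U(\mathfrak g)$, with $p$-map the $p$-th power map $(-)^p$ of $\mathrm U(\mathfrak g)$, and with product $\rhd$ the restriction to $\mathfrak g^{(p)}$ of the Guin-Oudom extension of $\rhd$ to $\mathrm U(\mathfrak g)$. Let $i:\mathfrak g\to\mathfrak g^{(p)}$ be the natural embedding. Then $(\mathfrak g^{(p)},[-,-],(-)^p,\rhd,i)$ is a universal $p$-envelope of the post-Lie algebra $(\mathfrak g,[-,-],\rhd)$ (in particular $(\mathfrak g^{(p)},[-,-],(-)^p,\rhd)$ is a restricted post-Lie algebra).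
   Context: Convention: $\mathbf k$ is an algebraically closed field of prime characteristic $p$; everything is over $\mathbf k$. Restricted Lie algebra: a Lie algebra $(\mathfrak g,[-,-])$ with a $p$-map $(-)^{[p]}:\mathfrak g\to\mathfrak g$ satisfying $(ax)^{[p]}=a^px^{[p]}$ for $a\in\mathbf k$, $[x^{[p]},y]=(\mathrm{ad}_x)^p(y)$, and $(x+y)^{[p]}=x^{[p]}+y^{[p]}+\sum_{i=1}^{p-1}s_i(x,y)$, where $i\,s_i(x,y)$ is the coefficient of $t^{i-1}$ in $(\mathrm{ad}_{tx+y})^{p-1}(x)\in\mathbf k[t]\otimes\mathfrak g$. Post-Lie algebra: a Lie algebra $(\mathfrak g,[-,-])$ with a bilinear product $\rhd$ such that $x\rhd[y,z]=[x\rhd y,z]+[y,x\rhd z]$ and $([x,y]+x\rhd y-y\rhd x)\rhd z=x\rhd(y\rhd z)-y\rhd(x\rhd z)$. Coefficients $C_\alpha$: for a composition $\alpha=(\alpha_1,\dots,\alpha_r)\vDash n$ (a tuple of positive integers with sum $n$, of length $\ell(\alpha)=r$), $C_\alpha=\prod_{k=1}^r\binom{\alpha_1+\cdots+\alpha_k-1}{\alpha_k-1}$. Restricted post-Lie algebra $(\mathfrak g,[-,-],(-)^{[p]},\rhd)$: a post-Lie algebra $(\mathfrak g,[-,-],\rhd)$ such that $(\mathfrak g,[-,-],(-)^{[p]})$ is a restricted Lie algebra and, for all $x,y$, $y\rhd x^{[p]}=(\mathrm{ad}_x)^{p-1}(y\rhd x)$ and $x^{\llbracket p\rrbracket}\rhd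 y=\underbrace{x\rhd(x\rhd\cdots(x}_{p}\rhd y)\cdots)$, where $$x^{\llbracket p\rrbracket}=x^{[p]}+\sum_{r=1}^{p-1}\frac1r\sum_{\alpha\vDash p,\ \ell(\alpha)=r}C_\alpha\,[x^{\rhd\alpha_1},[x^{\rhd\alpha_2},[\cdots[x^{\rhd\alpha_{r-1}},x^{\rhd\alpha_r}]\cdots]]],$$ with $x^{\rhd k}=x\rhd(x\rhd\cdots(x\rhd x)\cdots)$ ($k$ copies of $x$, $x^{\rhd1}=x$), and $\frac1r$ the inverse of $r$ modulo $p$. Homomorphisms of (restricted) post-Lie algebras are linear maps preserving $[-,-]$, $\rhd$ (and the $p$-maps). Guin-Oudom extension: $\mathrm U(\mathfrak g)$ carries its usual cocommutative Hopf structure (elements of $\mathfrak g$ primitive; Sweedler notation $\Delta(x)=x_1\otimes x_2$; counit $\varepsilon$). The product $\rhd$ of $\mathfrak g$ extends uniquely to a coalgebra map $\rhd:\mathrm U(\mathfrak g)\otimes\mathrm U(\mathfrak g)\to\mathrm U(\mathfrak g)$ with $1\rhd z=z$, $x\rhd1=\varepsilon(x)1$, $x\rhd(yz)=(x_1\rhd y)(x_2\rhd z)$ and $x\rhd(y\rhd z)=(x_1(x_2\rhd y))\rhd z$ for all $x,y,z\in\mathrm U(\mathfrak g)$. A $p$-subalgebra of a restricted post-Lie algebra is a post-Lie subalgebra closed under the $p$-map; for a subset $E$, $E_p$ denotes the intersection of all $p$-subalgebras containing $E$. A $p$-envelope of a post-Lie algebra $(\mathfrak g,\rhd)$ is a restricted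 post-Lie algebra $\mathfrak l$ with an injective post-Lie homomorphism $i:\mathfrak g\to\mathfrak l$ such that $i(\mathfrak g)_p=\mathfrak l$. It is universal if for every restricted post-Lie algebra $\mathfrak c$ and post-Lie homomorphism $f:\mathfrak g\to\mathfrak c$ there is a unique restricted post-Lie homomorphism $g:\mathfrak l\to\mathfrak c$ with $g\circ i=f$. *)

(* Defs.v *)
From HB Require Import structures.
From mathcomp Require Import all_boot all_order all_algebra.
From mathcomp Require Import finmap.
From mathcomp.classical Require Import boolp.
From mathcomp.multinomials Require Import monalg.

Set Implicit Arguments.
Unset Strict Implicit.
Unset Printing Implicit Defensive.

Import GRing.Theory.

Local Open Scope ring_scope.
Local Open Scope quotient_scope.

Definition is_bilinear (k : fieldType) (M N V : lmodType k)
    (B : M -> N -> V) : Prop :=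
  (forall x, linear (B x)) /\ (forall y, linear (B^~ y)).

Section Structures.
Variables (k : fieldType) (L : lmodType k).
Implicit Types (br rhd : L -> L -> L) (pm : L -> L).

Record is_lie br : Prop := IsLie {
  lie_bilinear : is_bilinear br;
  lie_alternating : forall x, br x x = 0;
  lie_jacobi : forall x y z,
    br x (br y z) + br y (br z x) + br z (br x y) = 0 }.

(* An element of k[t] (x) L is encoded by its coefficient sequence c : nat -> L,
   meaning the sum over n of t^n (x) c n; [ad_tD br x y] is then ad_(tx + y). *)
Definition ad_tD br (x y : L) (c : nat -> L) : nat -> L :=
  fun n => (if n is m.+1 then br x (c m) else 0) + br y (c n).

Definition jacobson_s (p : nat) br (i : nat) (x y : L) : L :=
  (i%:R)^-1 *: iter p.-1 (ad_tD br x y) (fun n => if n == 0%N then x else 0) i.-1.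

Record is_restricted_lie (p : nat) br pm : Prop := IsRestrictedLie {
  rlie_lie : is_lie br;
  pmapZ : forall (a : k) x, pm (a *: x) = a ^+ p *: pm x;
  pmap_ad : forall x y, br (pm x) y = iter p (br x) y;
  pmapD : forall x y,
    pm (x + y) = pm x + pm y + \sum_(1 <= i < p) jacobson_s p br i x y }.

Record is_post_lie br rhd : Prop := IsPostLie {
  plie_lie : is_lie br;
  plie_bilinear : is_bilinear rhd;
  plie_der : forall x y z, rhd x (br y z) = br (rhd x y) z + br y (rhd x z);
  plie_act : forall x y z,
    rhd (br x y + rhd x y - rhd y x) z = rhd x (rhd y z) - rhd y (rhd x z) }.

Definition comp_coef (a : seq nat) : nat :=
  \prod_(j < size a) 'C((sumn (take j.+1 a)).-1, (nth 0%N a j).-1).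

Fixpoint nested_br br (s : seq L) : L :=
  match s with
  | [::] => 0
  | [:: x] => x
  | x :: s' => br x (nested_br br s')
  end.

Definition rhd_pow rhd (x : L) (n : nat) : L := iter n.-1 (rhd x) x.

(* Compositions of p of length r are the r-tuples of positive numbers with sum
   p; their parts are at most p, so they are enumerated as tuples over 'I_p.+1. *)
Definition subadj_pmap (p : nat) br pm rhd (x : L) : L :=
  pm x +
  \sum_(1 <= r < p) (r%:R)^-1 *:
    \sum_(a : r.-tuple 'I_p.+1 |
            all (leq 1) (map val a) && (sumn (map val a) == p))
       (comp_coef (map val a))%:R *:
         nested_br br [seq rhd_pow rhd x j | j <- map val a].

Record is_restricted_post_lie (p : nat) br pm rhd : Prop :=
  IsRestrictedPostLie {
  rplie_plie : is_post_lie br rhd;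
  rplie_rlie : is_restricted_lie p br pm;
  rplie_der : forall x y, rhd y (pm x) = iter p.-1 (br x) (rhd y x);
  rplie_act : forall x y,
    rhd (subadj_pmap p br pm rhd x) y = iter p (rhd x) y }.

Record is_p_subalgebra br pm rhd (S : L -> Prop) : Prop := IsPSubalgebra {
  psub0 : S 0;
  psubP : forall (a : k) x y, S x -> S y -> S (a *: x + y);
  psub_br : forall x y, S x -> S y -> S (br x y);
  psub_rhd : forall x y, S x -> S y -> S (rhd x y);
  psub_pmap : forall x, S x -> S (pm x) }.

Definition p_closure br pm rhd (E : L -> Prop) (x : L) : Prop :=
  forall S, is_p_subalgebra br pm rhd S -> (forall y, E y -> S y) -> S x.

End Structures.

Record is_post_lie_hom (k : fieldType) (L M : lmodType k)
    (brL rhdL : L -> L -> L) (brM rhdM : M -> M -> M) (f : L -> M) : Prop :=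
  IsPostLieHom {
  plhom_linear : linear f;
  plhom_br : forall x y, f (brL x y) = brM (f x) (f y);
  plhom_rhd : forall x y, f (rhdL x y) = rhdM (f x) (f y) }.

Record is_restricted_post_lie_hom (k : fieldType) (L M : lmodType k)
    (brL : L -> L -> L) (pmL : L -> L) (rhdL : L -> L -> L)
    (brM : M -> M -> M) (pmM : M -> M) (rhdM : M -> M -> M)
    (f : L -> M) : Prop :=
  IsRestrictedPostLieHom {
  rplhom_plhom : is_post_lie_hom brL rhdL brM rhdM f;
  rplhom_pmap : forall x, f (pmL x) = pmM (f x) }.

Section PEnvelope.
Variables (k : fieldType) (p : nat) (g L : lmodType k).
Variables (br rhd : g -> g -> g).
Variables (brL : L -> L -> L) (pmL : L -> L) (rhdL : L -> L -> L) (i : g -> L).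

Record is_p_envelope : Prop := IsPEnvelope {
  penv_rplie : is_restricted_post_lie p brL pmL rhdL;
  penv_hom : is_post_lie_hom br rhd brL rhdL i;
  penv_inj : injective i;
  penv_gen : forall y, p_closure brL pmL rhdL (fun z => exists x, z = i x) y }.

Record is_universal_p_envelope : Prop := IsUniversalPEnvelope {
  upenv_penv : is_p_envelope;
  upenv_univ : forall (C : lmodType k)
      (brC : C -> C -> C) (pmC : C -> C) (rhdC : C -> C -> C),
    is_restricted_post_lie p brC pmC rhdC ->
    forall f : g -> C, is_post_lie_hom br rhd brC rhdC f ->
    exists! h : L -> C,
      is_restricted_post_lie_hom brL pmL rhdL brC pmC rhdC h /\
      (forall x, h (i x) = f x) }.

End PEnvelope.

Record is_uea (k : fieldType) (g : lmodType k) (br : g -> g -> g)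
    (U : algType k) (i : g -> U) : Prop := IsUea {
  uea_linear : linear i;
  uea_br : forall x y, i (br x y) = i x * i y - i y * i x;
  uea_univ : forall (A : algType k) (f : g -> A), linear f ->
    (forall x y, f (br x y) = f x * f y - f y * f x) ->
    exists2 h : {lrmorphism U -> A}, (forall x, h (i x) = f x) &
      forall h' : {lrmorphism U -> A}, (forall x, h' (i x) = f x) -> h' =1 h }.

(* The tensor product of the vector spaces A and B, with the product of
   algebras.  The uniqueness part of the universal property is tensor_span. *)
Record is_tensor_algebra (k : fieldType) (A B T : algType k)
    (pure : A -> B -> T) : Prop := IsTensorAlgebra {
  tensor_bilinear : is_bilinear pure;
  tensor_span : forall t, exists s : seq (A * B),
    t = \sum_(ab <- s) pure ab.1 ab.2;
  tensor_univ : forall (V : lmodType k) (F : A -> B -> V), is_bilinear F ->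
    exists2 h : T -> V, linear h & forall a b, h (pure a b) = F a b;
  tensor_one : pure 1 1 = 1;
  tensor_mul : forall a b c d, pure a b * pure c d = pure (a * c) (b * d) }.

(* Existence of these two objects: the first is the quotient of the free
   associative algebra on the set g, the second a quotient of the free module
   on A * B.  Everything below uses only the characteristic properties. *)
Module Construction.

Section MalgLin.
Variables (k : fieldType) (K : choiceType) (V : lmodType k).

Definition malg_lin (h : K -> V) (t : {malg k[K]}) : V :=
  \sum_(m <- msupp t) t@_m *: h m.

Lemma malg_linE h t : malg_lin h t = \sum_(m <- msupp t) t@_m *: h m.
Proof. by []. Qed.

Lemma malg_linEw h (d : {fset K}) (t : {malg k[K]}) :
  (msupp t `<=` d)%fset -> malg_lin h t = \sum_(m <- d) t@_m *: h m.
Proof.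
move=> le; rewrite /malg_lin (big_fset_incl _ le) => //= x xd /mcoeff_outdom ->.
by rewrite scale0r.
Qed.

Lemma malg_lin_linear h : linear (malg_lin h).
Proof.
move=> a s t; pose d := (msupp s `|` msupp t)%fset.
have ds : (msupp s `<=` d)%fset by apply: finmap.fsubsetUl.
have dt : (msupp t `<=` d)%fset by apply: finmap.fsubsetUr.
have dst : (msupp (a *: s + t) `<=` d)%fset.
  apply: (finmap.fsubset_trans (msuppD_le _ _)).
  exact: (finmap.fsetSU _ (msuppZ_le _ _)).
rewrite !(malg_linEw _ (d := d)) // scaler_sumr -big_split /=.
by apply: eq_bigr => m _; rewrite mcoeffD mcoeffZ scalerDl scalerA.
Qed.

Lemma malg_linU h a m : malg_lin h << a *g m >> = a *: h m.
Proof. by rewrite (malg_linEw _ msuppU_le) big_seq_fset1 mcoeffUU. Qed.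

Lemma malg_lin_uniq (f : {malg k[K]} -> V) h : linear f ->
  (forall m, f << 1 *g m >> = h m) -> f =1 malg_lin h.
Proof.
move=> fL fh t.
pose F := GRing.isLinear.Build _ _ _ _ f fL.
pose f' : {linear _ -> _} := HB.pack f F.
rewrite [t in LHS]monalgE -[f]/(f' : _ -> _) linear_sum /=.
apply: eq_bigr => m _; rewrite -fh -[f]/(f' : _ -> _) -linearZ /=; congr f.
by apply/malgP => n; rewrite mcoeffZ !mcoeffU mulr_natr.
Qed.

Lemma malg_lin_ext (f f' : {malg k[K]} -> V) : linear f -> linear f' ->
  (forall m, f << 1 *g m >> = f' << 1 *g m >>) -> f =1 f'.
Proof.
move=> fL fL' ff' t; rewrite (malg_lin_uniq fL ff').
by rewrite (malg_lin_uniq (f := f') fL' (fun=> erefl)).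
Qed.

Lemma malg_lin0 h : malg_lin h 0 = 0.
Proof. by rewrite /malg_lin msupp0 big_seq_fset0. Qed.

Lemma malg_linB h : {morph malg_lin h : s t / s - t}.
Proof.
move=> s t; rewrite [s - t]addrC -[- t]scaleN1r malg_lin_linear.
by rewrite scaleN1r addrC.
Qed.

Lemma malg_lin_lincomb h h1 h2 a t : (forall m, h m = a *: h1 m + h2 m) ->
  malg_lin h t = a *: malg_lin h1 t + malg_lin h2 t.
Proof.
move=> hE; rewrite /malg_lin scaler_sumr -big_split; apply: eq_bigr.
by move=> m _; rewrite hE scalerDr !scalerA mulrC.
Qed.

End MalgLin.

Opaque fgmul fgscale fgone mkmalgU mcoeff fgadd fgopp fgzero malg_lin.

Definition is_submodule (k : fieldType) (V : lmodType k) (S : V -> Prop) : Prop :=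
  S 0 /\ forall (a : k) x y, S x -> S y -> S (a *: x + y).

Definition is_ideal (k : fieldType) (A : lalgType k) (S : A -> Prop) : Prop :=
  is_submodule S /\ forall x y z, S y -> S (x * y * z).

Section LmodQuot.
Variables (k : fieldType) (V : lmodType k) (S : V -> Prop).
Hypothesis Ssub : is_submodule S.

Definition submodule_pred of is_submodule S : {pred V} := fun x => `[< S x >].
Local Notation Sb := (submodule_pred Ssub).

Fact submodule_pred_zmod : zmod_closed Sb.
Proof.
case: Ssub => S0 SD; split=> [|x y /asboolP Sx /asboolP Sy]; apply/asboolP => //.
by rewrite addrC -scaleN1r; apply: SD.
Qed.
HB.instance Definition _ := GRing.isZmodClosed.Build V Sb submodule_pred_zmod.

Definition quot_carrier := {ideal_quot Sb}.
HB.instance Definition _ := GRing.Zmodule.on quot_carrier.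

Let pi (x : V) : quot_carrier := \pi x.
Let rep (x : quot_carrier) : V := repr x.

Let repK : cancel rep pi. Proof. exact: reprK. Qed.

Let pi_eq (x y : V) : pi x = pi y <-> S (x - y).
Proof.
split=> [/eqP|Sxy].
  by rewrite -[_ == _](Quotient.idealrBE Sb) => /asboolP.
by apply/eqP; rewrite -[_ == _](Quotient.idealrBE Sb); apply/asboolP.
Qed.

Let piD : {morph pi : x y / x + y}.
Proof. exact: (Quotient.pi_add Sb). Qed.

Definition quot_scale (a : k) (x : quot_carrier) := pi (a *: rep x).

Let piZ a x : pi (a *: x) = quot_scale a (pi x).
Proof.
apply/pi_eq; rewrite -scalerBr -[_ *: _]addr0.
case: (Ssub) => S0 SD; apply: SD => //.
by apply/pi_eq; rewrite repK.
Qed.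

Fact quot_scaleA a b x : quot_scale a (quot_scale b x) = quot_scale (a * b) x.
Proof. by rewrite -[x]repK -!piZ scalerA. Qed.
Fact quot_scale1 : left_id 1 quot_scale.
Proof. by move=> x; rewrite -[x]repK -!piZ scale1r. Qed.
Fact quot_scaleDr : right_distributive quot_scale +%R.
Proof.
by move=> a x y; rewrite -[x]repK -[y]repK -piD -!piZ -piD scalerDr.
Qed.
Fact quot_scaleDl x : {morph quot_scale^~ x : a b / a + b}.
Proof. by move=> a b /=; rewrite -[x]repK -!piZ -piD scalerDl. Qed.

HB.instance Definition _ := GRing.Zmodule_isLmodule.Build k quot_carrier
  quot_scaleA quot_scale1 quot_scaleDr quot_scaleDl.

(* Only the characteristic properties of the quotient module V / S are kept:
   the construction above is sealed, so that it is never unfolded. *)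
Fact lmod_quot_ex : {Q : lmodType k & {f : V -> Q | [/\ linear f,
  forall q, exists x, f x = q & forall x y, f x = f y <-> S (x - y)]}}.
Proof.
exists quot_carrier; exists pi; split=> // [a x y|q]; last by exists (rep q).
by rewrite piD piZ.
Qed.

Definition lmod_quot : lmodType k := projT1 lmod_quot_ex.
Definition qproj : V -> lmod_quot := sval (projT2 lmod_quot_ex).

Lemma qproj_linear : linear qproj.
Proof. by rewrite /qproj; case: (projT2 _) => ? []. Qed.
Lemma qproj_surj q : exists x, qproj x = q.
Proof. by rewrite /qproj; case: (projT2 _) => ? []. Qed.
Lemma qproj_eq (x y : V) : qproj x = qproj y <-> S (x - y).
Proof. by rewrite /qproj; case: (projT2 _) => ? []. Qed.

Definition qrepr (q : lmod_quot) : V := sval (cid (qproj_surj q)).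

Lemma qreprK : cancel qrepr qproj.
Proof. by move=> q; rewrite /qrepr; case: cid. Qed.

Lemma qrepr_factor (W : lmodType k) (f : V -> W) x : linear f ->
  (forall y, S y -> f y = 0) -> f (qrepr (qproj x)) = f x.
Proof.
move=> fL f0; have /f0 : S (qrepr (qproj x) - x) by apply/qproj_eq; rewrite qreprK.
rewrite addrC -scaleN1r fL scaleN1r => /eqP.
by rewrite addrC subr_eq0 => /eqP.
Qed.

End LmodQuot.

Opaque qproj qrepr.

Section Tensor.
Variables (k : fieldType) (M N : lmodType k).
Local Notation F := {malg k[(M * N)%type]}.
Local Notation "[ x | y ]" := (<< 1 *g (x, y) >> : F).

Variant tens_rel : F -> Prop :=
| TensRelL a x x' y : tens_rel ([a *: x + x' | y] - (a *: [x | y] + [x' | y]))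
| TensRelR a x y y' : tens_rel ([x | a *: y + y'] - (a *: [x | y] + [x | y'])).

Definition tens_null (t : F) : Prop :=
  forall S, is_submodule S -> (forall r, tens_rel r -> S r) -> S t.

Fact tens_null_submod : is_submodule tens_null.
Proof.
split=> [|a x y Sx Sy] S Ssub SR; case: (Ssub) => S0 SD //.
by apply: SD; [apply: Sx | apply: Sy].
Qed.

Definition tens : Type := lmod_quot tens_null_submod.
HB.instance Definition _ := GRing.Lmodule.on tens.

Definition tproj : F -> tens := @qproj _ _ _ tens_null_submod.
Definition trepr : tens -> F := @qrepr _ _ _ tens_null_submod.

Lemma treprK : cancel trepr tproj. Proof. exact: qreprK. Qed.
Lemma tproj_linear : linear tproj. Proof. exact: qproj_linear. Qed.

Definition tpure (x : M) (y : N) : tens := tproj [x | y].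

Definition tlift (V : lmodType k) (B : M -> N -> V) (t : tens) : V :=
  malg_lin (fun xy => B xy.1 xy.2) (trepr t).

Lemma tpure_bilinear : is_bilinear tpure.
Proof.
split=> [x a y y'|y a x x'].
  rewrite /tpure; have <- := tproj_linear a [x | y] [x | y'].
  by apply/(qproj_eq tens_null_submod) => S _; apply; exact: TensRelR.
rewrite /tpure; have <- := tproj_linear a [x | y] [x' | y].
by apply/(qproj_eq tens_null_submod) => S _; apply; exact: TensRelL.
Qed.

Lemma tlift_pi (V : lmodType k) (B : M -> N -> V) (t : F) : is_bilinear B ->
  tlift B (tproj t) = malg_lin (fun xy => B xy.1 xy.2) t.
Proof.
move=> [BR BL]; apply: qrepr_factor; first exact: malg_lin_linear.
move=> y /(_ (fun t => malg_lin (fun xy => B xy.1 xy.2) t = 0)); apply.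
  split=> [|a u v Su Sv]; last by rewrite malg_lin_linear Su Sv scaler0 addr0.
  exact: malg_lin0.
move=> _ [a x x' y'|a x y' y'']; rewrite malg_linB malg_lin_linear !malg_linU /=.
  by rewrite !scale1r BL subrr.
by rewrite !scale1r BR subrr.
Qed.

Lemma tlift_linear (V : lmodType k) (B : M -> N -> V) :
  is_bilinear B -> linear (tlift B).
Proof.
move=> Bbil a s t; rewrite -[s]treprK -[t]treprK -tproj_linear.
by rewrite !tlift_pi // malg_lin_linear.
Qed.

Lemma tlift_pure (V : lmodType k) (B : M -> N -> V) x y :
  is_bilinear B -> tlift B (tpure x y) = B x y.
Proof. by move=> Bbil; rewrite tlift_pi // malg_linU scale1r. Qed.

Lemma tlift_lincomb (V : lmodType k) (B B1 B2 : M -> N -> V) a t :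
  (forall x y, B x y = a *: B1 x y + B2 x y) ->
  tlift B t = a *: tlift B1 t + tlift B2 t.
Proof.
by move=> BE; apply: malg_lin_lincomb => -[x y]; apply: BE.
Qed.

Lemma tens_ext (V : lmodType k) (f h : tens -> V) : linear f -> linear h ->
  (forall x y, f (tpure x y) = h (tpure x y)) -> f =1 h.
Proof.
move=> fL hL fh t; rewrite -[t]treprK.
pose H := fun xy : M * N => h (tpure xy.1 xy.2).
rewrite -[LHS]/((f \o tproj) _) -[RHS]/((h \o tproj) _).
rewrite (@malg_lin_uniq _ _ _ (f \o tproj) H).
- rewrite (@malg_lin_uniq _ _ _ (h \o tproj) H) //.
  + by move=> a x y /=; rewrite tproj_linear hL.
  + by case.
- by move=> a x y /=; rewrite tproj_linear fL.
- by case=> x y; apply: fh.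
Qed.

Lemma tens_span (t : tens) : exists s : seq (M * N),
  t = \sum_(ab <- s) tpure ab.1 ab.2.
Proof.
pose P u := exists s : seq (M * N), u = \sum_(ab <- s) tpure ab.1 ab.2.
have PD u v : P u -> P v -> P (u + v).
  by move=> [s ->] [s' ->]; exists (s ++ s'); rewrite big_cat.
have P0 : P 0 by exists [::]; rewrite big_nil.
have PZ a x y : P (a *: tpure x y).
  exists [:: (a *: x, y)]; rewrite big_seq1 /=.
  have [_ TL] := tpure_bilinear; have T0 : tpure 0 y = 0.
    by have := TL y (-1) 0 0; rewrite /= scaler0 addr0 scaleN1r addNr.
  by have := TL y a x 0; rewrite /= addr0 T0 addr0.
rewrite -/(P t) -[t]treprK.
rewrite [tproj _](malg_lin_uniq (h := fun xy => tpure xy.1 xy.2) tproj_linear).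
  by rewrite malg_linE; elim/big_rec: _ => // xy u _; apply: PD.
by case.
Qed.

End Tensor.

Section TensorRing.
Variables (k : fieldType) (A B : algType k).

Definition tens_one : tens A B := tpure 1 1.
Definition tens_mul (s t : tens A B) : tens A B :=
  tlift (fun a b => tlift (fun c d => tpure (a * c) (b * d)) t) s.

Let in_bil a b : is_bilinear (fun (c : A) (d : B) => tpure (a * c) (b * d)).
Proof.
case: (tpure_bilinear A B) => TR TL; split=> [c z d d'|d z c c'] /=.
  by rewrite mulrDr -scalerAr TR.
by rewrite mulrDr -scalerAr; apply: TL.
Qed.

Let out_bil (t : tens A B) : is_bilinear (fun (a : A) (b : B) =>
  tlift (fun (c : A) (d : B) => tpure (a * c) (b * d)) t).
Proof.
case: (tpure_bilinear A B) => TR TL; split=> [a z b b'|b z a a'] /=.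
  by apply: tlift_lincomb => c d; rewrite mulrDl -scalerAl TR.
by apply: tlift_lincomb => c d; rewrite mulrDl -scalerAl; apply: TL.
Qed.

Fact tens_mul_pure a b c d :
  tens_mul (tpure a b) (tpure c d) = tpure (a * c) (b * d).
Proof. by rewrite /tens_mul (tlift_pure _ _ (out_bil _)) tlift_pure. Qed.

Fact tens_mul_linl t : linear (tens_mul^~ t).
Proof. exact: tlift_linear. Qed.

Fact tens_mul_linr s : linear (tens_mul s).
Proof.
by move=> z t t'; apply: tlift_lincomb => a b; rewrite tlift_linear.
Qed.

Fact tens_mulA : associative tens_mul.
Proof.
move=> x y z; move: x; apply: tens_ext => [c u v|c u v|a b].
- by rewrite !tens_mul_linl.
- by rewrite !tens_mul_linl.
move: y; apply: tens_ext => [c u v|c u v|a' b'].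
- by rewrite tens_mul_linl !tens_mul_linr.
- by rewrite tens_mul_linr !tens_mul_linl.
move: z; apply: tens_ext => [c u v|c u v|a'' b''].
- by rewrite !tens_mul_linr.
- by rewrite !tens_mul_linr.
by rewrite !tens_mul_pure !mulrA.
Qed.
Fact tens_mul1 : left_id tens_one tens_mul.
Proof.
apply: tens_ext => [c u v|c u v|a b]; rewrite ?tens_mul_linr //.
by rewrite tens_mul_pure !mul1r.
Qed.
Fact tens_1mul : right_id tens_one tens_mul.
Proof.
apply: tens_ext => [c u v|c u v|a b]; rewrite ?tens_mul_linl //.
by rewrite tens_mul_pure !mulr1.
Qed.
Fact tens_mulDl : left_distributive tens_mul +%R.
Proof.
move=> x y z; rewrite -[X in tens_mul (X + _) _]scale1r tens_mul_linl.
by rewrite scale1r.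
Qed.
Fact tens_mulDr : right_distributive tens_mul +%R.
Proof.
move=> x y z; rewrite -[X in tens_mul _ (X + _)]scale1r tens_mul_linr.
by rewrite scale1r.
Qed.

Fact tens_mulZl a x y : a *: tens_mul x y = tens_mul (a *: x) y.
Proof.
have E0 : tens_mul 0 y = 0.
  by apply: (addrI (tens_mul 0 y)); rewrite -tens_mulDl !addr0.
by have := tens_mul_linl y a x 0; rewrite addr0 E0 addr0.
Qed.
Fact tens_mulZr a x y : a *: tens_mul x y = tens_mul x (a *: y).
Proof.
have E0 : tens_mul x 0 = 0.
  by apply: (addrI (tens_mul x 0)); rewrite -tens_mulDr !addr0.
by have := tens_mul_linr x a y 0; rewrite addr0 E0 addr0.
Qed.

Opaque tens_one tens_mul.
HB.instance Definition _ := GRing.Zmodule_isPzRing.Build (tens A B)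
  tens_mulA tens_mul1 tens_1mul tens_mulDl tens_mulDr.

Lemma tpureM a b c d : tpure a b * tpure c d = tpure (a * c) (b * d) :> tens A B.
Proof. exact: tens_mul_pure. Qed.

End TensorRing.

Opaque tens_one tens_mul.

Section TensorEx.
Variables (k : fieldType) (A B : algType k).

Fact tensor_algebra_ex :
  (exists2 e : A -> k^o, linear e & e 1 = 1) ->
  (exists2 e : B -> k^o, linear e & e 1 = 1) ->
  {T : algType k & {pure : A -> B -> T | is_tensor_algebra pure}}.
Proof.
move=> eA eB.
have nz : (1 : tens A B) != 0.
  have [e eL e1] := eA; have [f fL f1] := eB.
  pose E : A -> B -> k^o := fun a b => e a * f b.
  have Ebil : is_bilinear E.
    split=> [a z b b'|b z a a']; rewrite /E.
      by rewrite fL mulrDr [e a * (z *: f b)]mulrCA.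
    by rewrite eL mulrDl -scalerAl.
  apply/eqP => /(congr1 (tlift E)).
  rewrite -[1]/(tpure 1 1) tlift_pure // /E e1 f1 mulr1.
  have := tlift_linear Ebil (-1) 0 0.
  by rewrite scaler0 addr0 scaleN1r addNr => -> /eqP; rewrite oner_eq0.
pose m0 := GRing.PzSemiRing_isNonZero.Build (tens A B) nz.
pose T0 : nzRingType := HB.pack (tens A B) m0.
pose m1 := GRing.LSemiModule_isLSemiAlgebra.Build k T0 (@tens_mulZl k A B).
pose T1 : lalgType k := HB.pack (tens A B) m0 m1.
pose m2 := GRing.LSemiAlgebra_isSemiAlgebra.Build k T1 (@tens_mulZr k A B).
pose T2 : algType k := HB.pack (tens A B) m0 m1 m2.
exists T2; exists (@tpure k A B); split.
- exact: tpure_bilinear.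
- exact: tens_span.
- move=> V F Fbil; exists (tlift F); first exact: tlift_linear.
  by move=> a b; apply: tlift_pure.
- by [].
- exact: tpureM.
Qed.

End TensorEx.

Fact comm_morph (R S : pzRingType) (c : R -> S) :
  {morph c : x y / x - y} -> {morph c : x y / x * y} ->
  forall x y, c (x * y - y * x) = c x * c y - c y * c x.
Proof. by move=> cB cM x y; rewrite cB !cM. Qed.

Section Uea.
Variables (k : fieldType) (g : lmodType k) (br : g -> g -> g).
Local Notation F := {malg k[{fmonom g}]}.
Local Notation "[ x ]" := (<< 1 *g fmu x >> : F).

(* F is the free associative algebra on the set g; the first relation turns it
   into the tensor algebra of the vector space g. *)
Variant uea_rel : F -> Prop :=
| UeaRelLin a x y : uea_rel ([a *: x + y] - (a *: [x] + [y]))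
| UeaRelBr x y : uea_rel ([x] * [y] - [y] * [x] - [br x y]).

Definition uea_null (t : F) : Prop :=
  forall S, is_ideal S -> (forall r, uea_rel r -> S r) -> S t.

Fact uea_null_ideal : is_ideal uea_null.
Proof.
split; first split=> [|a x y Sx Sy] S Sid SR; last move=> x y z Sy S Sid SR.
- by case: Sid => -[].
- by case: (Sid) => -[S0 SD] _; apply: SD; [apply: Sx | apply: Sy].
- by case: (Sid) => _; apply; apply: Sy.
Qed.
Fact uea_null_submod : is_submodule uea_null. Proof. by case: uea_null_ideal. Qed.

Definition uea : Type := lmod_quot uea_null_submod.
HB.instance Definition _ := GRing.Lmodule.on uea.

Definition uproj : F -> uea := @qproj _ _ _ uea_null_submod.
Definition urepr : uea -> F := @qrepr _ _ _ uea_null_submod.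

Lemma ureprK : cancel urepr uproj. Proof. exact: qreprK. Qed.
Lemma uproj_linear : linear uproj. Proof. exact: qproj_linear. Qed.
Lemma uproj_eq (x y : F) : uproj x = uproj y <-> uea_null (x - y).
Proof. exact: qproj_eq. Qed.
Lemma uproj0 : uproj 0 = 0.
Proof.
have := uproj_linear (-1) 0 0.
by rewrite scaler0 addr0 scaleN1r addNr.
Qed.
Lemma uprojD : {morph uproj : x y / x + y}.
Proof. by move=> x y; have := uproj_linear 1 x y; rewrite !scale1r. Qed.
Lemma uprojZ a : {morph uproj : x / a *: x}.
Proof.
by move=> x; have := uproj_linear a x 0; rewrite uproj0 !addr0.
Qed.
Lemma uprojB : {morph uproj : x y / x - y}.
Proof.
move=> x y; rewrite [x - y]addrC -[- y]scaleN1r uproj_linear.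
by rewrite scaleN1r addrC.
Qed.

Definition uea_one : uea := uproj 1.
Definition uea_mul (x y : uea) : uea := uproj (urepr x * urepr y).

Fact uprojM : {morph uproj : x y / x * y >-> uea_mul x y}.
Proof.
case: uea_null_ideal => -[N0 ND] NM.
have rN x : uea_null (x - urepr (uproj x)) by apply/uproj_eq; rewrite ureprK.
move=> x y; apply/uproj_eq.
have -> : x * y - urepr (uproj x) * urepr (uproj y)
  = 1 *: (1 * (x - urepr (uproj x)) * y) +
    urepr (uproj x) * (y - urepr (uproj y)) * 1.
  by rewrite scale1r mul1r mulr1 mulrBl mulrBr addrA subrK.
by apply: ND; apply: NM.
Qed.

Fact uea_mulA : associative uea_mul.
Proof.
by move=> x y z; rewrite -[x]ureprK -[y]ureprK -[z]ureprK -!uprojM mulrA.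
Qed.
Fact uea_mul1 : left_id uea_one uea_mul.
Proof. by move=> x; rewrite -[x]ureprK -!uprojM mul1r. Qed.
Fact uea_1mul : right_id uea_one uea_mul.
Proof. by move=> x; rewrite -[x]ureprK -!uprojM mulr1. Qed.
Fact uea_mulDl : left_distributive uea_mul +%R.
Proof.
move=> x y z; rewrite -[x]ureprK -[y]ureprK -[z]ureprK.
by rewrite -uprojD -!uprojM -uprojD mulrDl.
Qed.
Fact uea_mulDr : right_distributive uea_mul +%R.
Proof.
move=> x y z; rewrite -[x]ureprK -[y]ureprK -[z]ureprK.
by rewrite -uprojD -!uprojM -uprojD mulrDr.
Qed.
Fact uea_one_neq0 : uea_one != 0.
Proof.
rewrite -uproj0.
have [c [cP cM c1 cgen]] : exists c : F -> k, [/\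
    forall a x y, c (a *: x + y) = a * c x + c y,
    {morph c : x y / x * y}, c 1 = 1 & forall x, c [x] = 0].
  exists (mcoeff mone); split=> [a x y|x y||x].
  - by rewrite mcoeffD mcoeffZ.
  - exact: rmorphM.
  - exact: rmorph1.
  - by rewrite mcoeffU -[_ == _]/(_ == _ :> {fmonom g}) fmP fmU fm1.
have cB x y : c (x - y) = c x - c y by rewrite addrC -scaleN1r cP mulN1r addrC.
have c0 : c 0 = 0 by rewrite -(subrr 0) cB subrr.
have cLin a X Y Z : c X = 0 -> c Y = 0 -> c Z = 0 -> c (X - (a *: Y + Z)) = 0.
  by move=> cX cY cZ; rewrite cB cP cX cY cZ mulr0 addr0 subrr.
have cComm X Y Z : c X = 0 -> c Y = 0 -> c Z = 0 -> c (X * Y - Y * X - Z) = 0.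
  by move=> cX cY cZ; rewrite cB (comm_morph cB cM) cX cY cZ mulr0 !subrr.
apply/eqP => /uproj_eq; rewrite subr0 => /(_ (fun t => c t = 0)) c10.
suff: c 1 = 0 by rewrite c1 => /eqP; rewrite oner_eq0.
apply: c10; first split; first split=> //.
- by move=> a x y cx cy; rewrite cP cx cy mulr0 addr0.
- by move=> x y z cy; rewrite !cM cy mulr0 mul0r.
- move=> _ [a x y|x y].
    by apply: cLin; apply: cgen.
  by apply: cComm; apply: cgen.
Qed.

HB.instance Definition _ := GRing.Zmodule_isNzRing.Build uea
  uea_mulA uea_mul1 uea_1mul uea_mulDl uea_mulDr uea_one_neq0.

Fact malg_scalerAr (a : k) (x y : F) : a *: (x * y) = x * (a *: y).
Proof.
apply/malgP => m; rewrite mcoeffZ [in RHS]mcoeffMl [in LHS]mcoeffMl big_distrr /=.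
apply: eq_bigr => i _; rewrite big_distrr /=.
have -> : \sum_(j <- msupp (a *: y)) (x@_i * (a *: y)@_j) *+ (mmul i j == m) =
          \sum_(j <- msupp y) (x@_i * (a *: y)@_j) *+ (mmul i j == m).
  apply: big_fset_incl; first exact: msuppZ_le.
  by move=> j _ /mcoeff_outdom ->; rewrite mulr0 mul0rn.
by apply: eq_bigr => j _; rewrite mcoeffZ mulrnAr mulrCA.
Qed.

Fact uea_scalerAl (a : k) (x y : uea) : a *: (x * y) = (a *: x) * y.
Proof.
rewrite -[x]ureprK -[y]ureprK -[_ * _ in LHS]uprojM -!uprojZ -[RHS]uprojM.
by rewrite scalerAl.
Qed.
HB.instance Definition _ := GRing.Lmodule_isLalgebra.Build k uea uea_scalerAl.

Fact uea_scalerAr (a : k) (x y : uea) : a *: (x * y) = x * (a *: y).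
Proof.
rewrite -[x]ureprK -[y]ureprK -[_ * _ in LHS]uprojM -!uprojZ -[RHS]uprojM.
by rewrite malg_scalerAr.
Qed.
HB.instance Definition _ := GRing.Lalgebra_isAlgebra.Build k uea uea_scalerAr.

Definition uea_inj (x : g) : uea := uproj [x].

Lemma uea_inj_linear : linear uea_inj.
Proof.
move=> a x y; rewrite /uea_inj -uproj_linear; apply/uproj_eq => S _; apply.
exact: UeaRelLin.
Qed.

Lemma uea_inj_br x y :
  uea_inj (br x y) = uea_inj x * uea_inj y - uea_inj y * uea_inj x.
Proof.
have E X Y : uproj (X * Y - Y * X) = uproj X * uproj Y - uproj Y * uproj X.
  exact: (comm_morph uprojB uprojM).
rewrite /uea_inj -E.
by apply/esym/uproj_eq => S _; apply; apply: UeaRelBr.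
Qed.

Definition uea_lift (A : algType k) (f : g -> A) (u : uea) : A :=
  malg_lin (fun m : {fmonom g} => \prod_(x <- (m : seq g)) f x) (urepr u).

Section Lift.
Variables (A : algType k) (f : g -> A).
Hypothesis fL : linear f.
Hypothesis fbr : forall x y, f (br x y) = f x * f y - f y * f x.

Let fF : F -> A := malg_lin (fun m : {fmonom g} => \prod_(x <- (m : seq g)) f x).

Let fFB x y : fF (x - y) = fF x - fF y. Proof. exact: malg_linB. Qed.

Let fFgen x : fF [x] = f x.
Proof. by rewrite /fF malg_linU scale1r fmU big_seq1. Qed.

Let fFM x y : fF (x * y) = fF x * fF y.
Proof.
have Llin : linear (fun t => fF (t * y)).
  by move=> a u v; rewrite mulrDl -scalerAl /fF malg_lin_linear.
have Rlin : linear (fun t => fF t * fF y).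
  by move=> a u v; rewrite /fF malg_lin_linear mulrDl scalerAl.
apply: (malg_lin_ext Llin Rlin) x => m.
have Llin' : linear (fun t => fF (<< 1 *g m >> * t)).
  by move=> a u v; rewrite mulrDr -malg_scalerAr /fF malg_lin_linear.
have Rlin' : linear (fun t => fF << 1 *g m >> * fF t).
  by move=> a u v; rewrite /fF malg_lin_linear mulrDr scalerAr.
clear Llin Rlin; apply: (malg_lin_ext Llin' Rlin') y => n.
by rewrite malgM_def fgmulUU mulr1 /fF !malg_linU !scale1r fmM big_cat.
Qed.

Let fF_lin a X Y Z : fF X = a *: fF Y + fF Z -> fF (X - (a *: Y + Z)) = 0.
Proof. by move=> E; rewrite fFB E /fF malg_lin_linear subrr. Qed.

Let fF_comm X Y Z :
  fF Z = fF X * fF Y - fF Y * fF X -> fF (X * Y - Y * X - Z) = 0.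
Proof. by move=> E; rewrite fFB (comm_morph fFB fFM) E subrr. Qed.

Let fF_null t : uea_null t -> fF t = 0.
Proof.
move/(_ (fun t => fF t = 0)); apply; first split; first split.
- exact: malg_lin0.
- by move=> a x y; rewrite /fF malg_lin_linear => -> ->; rewrite scaler0 addr0.
- by move=> x y z y0; rewrite !fFM y0 mulr0 mul0r.
move=> _ [a x y|x y].
  by apply: fF_lin; rewrite !fFgen fL.
by apply: fF_comm; rewrite !fFgen fbr.
Qed.

Lemma uea_lift_proj t : uea_lift f (uproj t) = fF t.
Proof. by apply: qrepr_factor; [apply: malg_lin_linear | apply: fF_null]. Qed.

Lemma uea_lift_inj x : uea_lift f (uea_inj x) = f x.
Proof. by rewrite uea_lift_proj fFgen. Qed.

Lemma uea_lift_linear : linear (uea_lift f).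
Proof.
move=> a x y; rewrite -[x]ureprK -[y]ureprK -uproj_linear !uea_lift_proj.
by rewrite /fF malg_lin_linear.
Qed.

Lemma uea_lift_monoid : monoid_morphism (uea_lift f).
Proof.
split=> [|x y].
  rewrite -[1]/(uproj 1) uea_lift_proj -[1 in LHS]/(<< 1 *g mone >>).
  by rewrite /fF malg_linU scale1r fm1 big_nil.
by rewrite -[x]ureprK -[y]ureprK -[_ * _ in LHS]uprojM !uea_lift_proj fFM.
Qed.

Lemma uea_lift_unique (h : {lrmorphism uea -> A}) :
  (forall x, h (uea_inj x) = f x) -> h =1 uea_lift f.
Proof.
move=> hf u; rewrite -[u]ureprK uea_lift_proj.
apply: (malg_lin_uniq (f := h \o uproj)).
  by move=> a x y /=; rewrite uproj_linear linearP.
case; elim=> [|x s IHs] /=.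
  rewrite big_nil -(rmorph1 h); congr (h (uproj << _ *g _ >>)).
  by apply/eqP; rewrite fmP fm1.
rewrite big_cons -IHs -hf -rmorphM; congr (h _).
by rewrite /uea_inj -[RHS]uprojM malgM_def fgmulUU mulr1; congr (uproj << _ *g _ >>);
   apply/eqP; rewrite fmP fmM fmU.
Qed.

End Lift.

End Uea.

Fact uea_ex (k : fieldType) (g : lmodType k) (br : g -> g -> g) :
  {U : algType k & {i : g -> U | is_uea br i}}.
Proof.
exists (uea br); exists (@uea_inj k g br); split.
- exact: uea_inj_linear.
- exact: uea_inj_br.
move=> A f fL fbr.
pose mL := GRing.isLinear.Build k (uea br) A _ _ (uea_lift_linear fL fbr).
pose mM := GRing.isMonoidMorphism.Build (uea br) A _ (uea_lift_monoid fL fbr).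
pose h : {lrmorphism uea br -> A} := HB.pack (uea_lift (br := br) f) mL mM.
exists h; first exact: uea_lift_inj.
by move=> h' h'f; apply: uea_lift_unique.
Qed.

End Construction.

Section Hopf.
Variables (k : fieldType) (g : lmodType k) (br : g -> g -> g).

Definition uea : algType k := projT1 (Construction.uea_ex br).
Definition uea_inj : g -> uea := sval (projT2 (Construction.uea_ex br)).

Lemma ueaP : is_uea br uea_inj.
Proof. exact: (svalP (projT2 (Construction.uea_ex br))). Qed.

Definition uea_lift (A : algType k) (f : g -> A) (fL : linear f)
    (fbr : forall x y, f (br x y) = f x * f y - f y * f x) :
  {lrmorphism uea -> A} := s2val (cid2 (uea_univ ueaP fL fbr)).

Lemma uea_liftE (A : algType k) (f : g -> A) fL fbr x :
  @uea_lift A f fL fbr (uea_inj x) = f x.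
Proof. exact: (s2valP (cid2 (uea_univ ueaP fL fbr))). Qed.

Fact zero_linear : linear (fun _ : g => 0 : k^o).
Proof. by move=> a x y; rewrite scaler0 addr0. Qed.
Fact zero_br (x y : g) : (0 : k^o) = 0 * 0 - 0 * 0.
Proof. by rewrite mul0r subrr. Qed.

Definition uea_counit : {lrmorphism uea -> k^o} := uea_lift zero_linear zero_br.

Fact uea_tensor_ex :
  {T : algType k & {pure : uea -> uea -> T | is_tensor_algebra pure}}.
Proof.
by apply: Construction.tensor_algebra_ex; exists uea_counit;
   [exact: linearP | exact: rmorph1 | exact: linearP | exact: rmorph1].
Qed.

Definition uea2 : algType k := projT1 uea_tensor_ex.
Definition tpure : uea -> uea -> uea2 := sval (projT2 uea_tensor_ex).

Lemma tpureP : is_tensor_algebra tpure.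
Proof. exact: (svalP (projT2 uea_tensor_ex)). Qed.

Definition prim (x : g) : uea2 := tpure (uea_inj x) 1 + tpure 1 (uea_inj x).

Fact prim_linear : linear prim.
Proof.
case: (tensor_bilinear tpureP) => TR TL a x y.
rewrite /prim (uea_linear ueaP) TR.
by rewrite (TL 1 a (uea_inj x) (uea_inj y) : tpure _ _ = _) scalerDr addrACA.
Qed.

Fact prim_br x y : prim (br x y) = prim x * prim y - prim y * prim x.
Proof.
case: (tensor_bilinear tpureP) => TR TL; have TM := tensor_mul tpureP.
rewrite /prim (uea_br ueaP) !mulrDl !mulrDr !TM !mul1r !mulr1.
set u := uea_inj x; set v := uea_inj y.
have -> : tpure (u * v - v * u) 1 = tpure (u * v) 1 - tpure (v * u) 1.
  rewrite [u * v - _]addrC -[- (v * u)]scaleN1r.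
  by rewrite (TL 1 (-1) (v * u) (u * v) : tpure _ _ = _) scaleN1r addrC.
have -> : tpure 1 (u * v - v * u) = tpure 1 (u * v) - tpure 1 (v * u).
  by rewrite [u * v - _]addrC -[- (v * u)]scaleN1r TR scaleN1r addrC.
set a := tpure (u * v) 1; set b := tpure u v; set c := tpure v u.
set d := tpure 1 (u * v); set e := tpure (v * u) 1; set f := tpure 1 (v * u).
have -> : a + b + (c + d) = (b + c) + (a + d) by rewrite [a + b]addrC addrACA.
have -> : e + c + (b + f) = (b + c) + (e + f).
  by rewrite [e + c]addrC addrACA [c + b]addrC.
by rewrite [in RHS]opprD [RHS]addrACA subrr add0r opprD addrACA.
Qed.

Definition uea_comul : {lrmorphism uea -> uea2} := uea_lift prim_linear prim_br.

(* A Sweedler decomposition Delta(u) = sum of u_1 (x) u_2. *)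
Definition sweedler (u : uea) : seq (uea * uea) :=
  sval (cid (tensor_span tpureP (uea_comul u))).

Lemma sweedlerE u : uea_comul u = \sum_(t <- sweedler u) tpure t.1 t.2.
Proof. exact: (svalP (cid (tensor_span tpureP (uea_comul u)))). Qed.

End Hopf.

Section GuinOudom.
Variables (k : fieldType) (g : lmodType k) (br rhd : g -> g -> g).
Local Notation U := (uea br).

(* The coproduct of uea (x) uea sends x (x) y to the sum of
   (x_1 (x) y_1) (x) (x_2 (x) y_2). *)
Record is_guin_oudom (rhdU : U -> U -> U) : Prop := IsGuinOudom {
  go_bilinear : is_bilinear rhdU;
  go_ext : forall x y : g,
    rhdU (uea_inj br x) (uea_inj br y) = uea_inj br (rhd x y);
  go_comul : forall x y : U,
    uea_comul br (rhdU x y) = \sum_(s <- sweedler x) \sum_(t <- sweedler y)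
      tpure (rhdU s.1 t.1) (rhdU s.2 t.2);
  go_counit : forall x y : U,
    uea_counit br (rhdU x y) = uea_counit br x * uea_counit br y;
  go_1l : forall z : U, rhdU 1 z = z;
  go_1r : forall x : U, rhdU x 1 = (uea_counit br x : k) *: 1;
  go_mul : forall x y z : U,
    rhdU x (y * z) = \sum_(s <- sweedler x) rhdU s.1 y * rhdU s.2 z;
  go_rhd : forall x y z : U,
    rhdU x (rhdU y z) = rhdU (\sum_(s <- sweedler x) s.1 * rhdU s.2 y) z }.

End GuinOudom.

Section GP.
Variables (k : fieldType) (p : nat) (g : lmodType k) (br : g -> g -> g).
Local Notation U := (uea br).

(* Linear combinations of the powers x ^ (p ^ e), listed as triples
   (coefficient, x, e). *)
Definition uea_gp : {pred U} := fun u => `[< exists s : seq (k * g * nat),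
  u = \sum_(t <- s) t.1.1 *: uea_inj br t.1.2 ^+ (p ^ t.2) >].

Fact uea_gp_zmod : zmod_closed uea_gp.
Proof.
split; first by apply/asboolP; exists [::]; rewrite big_nil.
move=> u v /asboolP[s ->] /asboolP[t ->]; apply/asboolP.
exists (s ++ [seq (- x.1.1, x.1.2, x.2) | x <- t]).
rewrite big_cat big_map -sumrN /=; congr (_ + _).
by apply: eq_bigr => x _; rewrite scaleNr.
Qed.
HB.instance Definition _ := GRing.isZmodClosed.Build U uea_gp uea_gp_zmod.

Fact uea_gp_scale : GRing.scaler_closed uea_gp.
Proof.
move=> a u /asboolP[s ->]; apply/asboolP.
exists [seq (a * x.1.1, x.1.2, x.2) | x <- s].
by rewrite big_map scaler_sumr; apply: eq_bigr => x _; rewrite scalerA.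
Qed.
HB.instance Definition _ := GRing.isScaleClosed.Build k U uea_gp uea_gp_scale.

Record gp := GP { gp_val : U; _ : gp_val \in uea_gp }.
HB.instance Definition _ := [isSub for gp_val].
HB.instance Definition _ := [Choice of gp by <:].
HB.instance Definition _ := [SubChoice_isSubZmodule of gp by <:].
HB.instance Definition _ := [SubZmodule_isSubLmodule of gp by <:].

Fact uea_inj_gp x : uea_inj br x \in uea_gp.
Proof.
by apply/asboolP; exists [:: (1, x, 0%N)]; rewrite big_seq1 expn0 expr1 scale1r.
Qed.

Definition gp_inj (x : g) : gp := GP (uea_inj_gp x).

End GP.

(* Main.v *)
From HB Require Import structures.
Require Import Defs.
From mathcomp Require Import all_boot all_order all_algebra.
From mathcomp Require Import finmap.
From mathcomp.classical Require Import boolp wochoice.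
From mathcomp.multinomials Require Import monalg.

Set Implicit Arguments.
Unset Strict Implicit.
Unset Printing Implicit Defensive.

Import GRing.Theory.
Import Construction(is_submodule, malg_lin, malg_linE, malg_lin_linear, malg_linU,
  malg_lin_uniq, malg_lin0, malg_linB, malg_lin_lincomb).
Local Open Scope ring_scope.

(** Every element u of g^(p) is primitive, so D = (u |> -) is a derivation of
    U(g) and u |> (v |> z) = (u v + u |> v) |> z.  Hence (u |> -)^p is the action
    of (L_u + D)^p(1), and the restricted post-Lie axiom on u^[[p]] amounts to
    (L_u + D)^p(1) = u^[[p]].  This is an instance of Jacobson's formula: in
    characteristic p the t-derivative of (L_(tx + y) + D)^p(1) is
    (ad_(tx + y) + D)^(p-1)(x), by the Leibniz rule E(bv) = F(b)v + bE(v) for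
    E = L_(tx + y) + D and F = ad_(tx + y) + D.  D = 0 gives Jacobson's formula for
    (x + y)^p, y = 0 gives u^[[p]], because expanding (t ad_u + D)^(p-1)(u) yields
    exactly the coefficients C_a.

    For universality, a Poincare-Birkhoff-Witt module (g acting on the span of
    the sorted words in an ordered basis B of g) provides linear maps on U(g)
    with prescribed values on the powers b^n, b in B, n > 0.  The one with
    b^(p^e) |-> f(b)^([p]^e) restricts to the required morphism, since g^(p) is
    spanned by the b^(p^e) and both brackets and products of elements of g^(p)
    fall back into g. *)

(** * Powers in characteristic p *)

Section Leibniz.
Variables (T : Type) (V : zmodType) (op : T -> V -> V) (F : T -> T) (E : V -> V).
Hypothesis ED : {morph E : x y / x + y}.
Hypothesis EF : forall b v, E (op b v) = op (F b) v + op b (E v).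

Lemma iter_additive n : {morph iter n E : x y / x + y}.
Proof. by elim: n => [//|n IHn] x y; rewrite !iterS IHn ED. Qed.

(** Pascal's identity. This form serves both for a product, with [E] a left multiplication and [F]
    the commutator (possibly plus a derivation), and for a bracket, with [E] and [F] the same
    derivation. *)
Lemma iter_leibniz n b v : iter n E (op b v) =
  \sum_(i < n.+1) op (iter i F b) (iter (n - i) E v) *+ 'C(n, i).
Proof.
elim: n b v => [|n IHn] b v; first by rewrite big_ord1 /= bin0.
rewrite iterSr EF iter_additive !IHn.
have -> : \sum_(i < n.+1) op (iter i F b) (iter (n - i) E (E v)) *+ 'C(n, i) =
    \sum_(i < n.+2) op (iter i F b) (iter (n.+1 - i) E v) *+ 'C(n, i).
  rewrite [RHS]big_ord_recr /= bin_small // mulr0n addr0.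
  by apply: eq_bigr => i _; rewrite subSn ?iterSr //; apply: (ltn_ord i).
rewrite [RHS]big_ord_recl [X in _ + X = _]big_ord_recl /= !bin0 addrCA; congr (_ + _).
rewrite -big_split; apply: eq_bigr => i _ /=.
by rewrite /bump /= add1n subSS binS mulrnDr addrC -iterSr.
Qed.

(** After [iter_leibniz] the coefficients on the left add up to C(n, i+1) by the hockey-stick
    identity; the induction peels off the last term and uses Pascal's rule. *)
Lemma sum_iter_leibniz n b v :
  \sum_(j < n) iter j E (op b (iter (n.-1 - j) E v)) =
  \sum_(i < n) op (iter i F b) (iter (n.-1 - i) E v) *+ 'C(n, i.+1).
Proof.
elim: n v => [|n IHn] v; first by rewrite !big_ord0.
have shift (j : 'I_n) : iter (n - j) E v = iter (n.-1 - j) E (E v).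
  by rewrite -iterSr -subSn ?prednK //; case: n j {IHn} => [[]//|n j]; rewrite -ltnS.
rewrite big_ord_recr /= subnn /= iter_leibniz.
under eq_bigr => j _ do rewrite shift.
rewrite IHn; under [RHS]eq_bigr => i _ do rewrite binS mulrnDr.
rewrite big_split /= addrC [in RHS]addrC; congr (_ + _).
rewrite big_ord_recr /= bin_small // mulr0n addr0; apply: eq_bigr => i _.
by rewrite shift.
Qed.

Variable p : nat.
Hypothesis p_prime : prime p.
Hypothesis Vp : forall v : V, v *+ p = 0.

Let mulrn_bin (v : V) i : (0 < i < p)%N -> v *+ 'C(p, i) = 0.
Proof. by move/(prime_dvd_bin p_prime)/dvdnP=> [q ->]; rewrite mulrnA Vp. Qed.

Lemma iter_leibniz_pchar b v :
  iter p E (op b v) = op (iter p F b) v + op b (iter p E v).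
Proof.
rewrite iter_leibniz; case: p (prime_gt0 p_prime) mulrn_bin => // q _ bin0_.
rewrite big_ord_recl big_ord_recr /= bin0 binn subnn ?subn0 !mulr1n.
rewrite [RHS]addrC; congr (_ + _); rewrite big1 ?add0r // => i _.
by rewrite bin0_ //= ltnS ltn_ord.
Qed.

(** Only i = p - 1 survives, since p divides C(p, i+1) when i+1 < p. *)
Lemma sum_iter_leibniz_pchar b v :
  \sum_(j < p) iter j E (op b (iter (p.-1 - j) E v)) = op (iter p.-1 F b) v.
Proof.
rewrite sum_iter_leibniz; case: p (prime_gt0 p_prime) mulrn_bin => // q _ bin0_.
rewrite big_ord_recr /= binn subnn mulr1n big1 ?add0r // => i _.
by rewrite bin0_ //= ltnS ltn_ord.
Qed.

End Leibniz.

Definition comm (R : pzRingType) (x y : R) : R := x * y - y * x.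

Section CommPchar.
Variables (R : nzRingType) (p : nat).
Hypothesis charp : p \in [pchar R].

Lemma comm_leibniz (a b v : R) : a * (b * v) = comm a b * v + b * (a * v).
Proof. by rewrite /comm mulrBl !mulrA subrK. Qed.

(** With E = L_a and F = ad_a, [iter_leibniz_pchar] at v = 1 reads a^p b = (ad_a)^p(b) + b a^p. *)
Lemma comm_exp_pchar (a b : R) : comm (a ^+ p) b = iter p (comm a) b.
Proof.
have aD : {morph *%R a : x y / x + y} by move=> x y; rewrite mulrDr.
have := iter_leibniz_pchar aD (comm_leibniz a)
  (pcharf_prime charp) (mulrn_pchar charp) b 1.
rewrite !mulr1 /comm.
have E n v : iter n ( *%R a) v = a ^+ n * v.
  by elim: n => [|n IHn]; rewrite ?mul1r //= IHn mulrA -exprS.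
by rewrite !E mulr1 => ->; rewrite addrK.
Qed.

Lemma derivation_exp (D : R -> R) n (a : R) : D 1 = 0 ->
  (forall x y, D (x * y) = D x * y + x * D y) ->
  D (a ^+ n) = \sum_(j < n) a ^+ j * D a * a ^+ (n.-1 - j).
Proof.
move=> D1 DM; elim: n => [|n IHn]; first by rewrite big_ord0.
rewrite exprS DM IHn big_ord_recl mul1r subn0 /=; congr (_ + _).
rewrite mulr_sumr; apply: eq_bigr => i _; rewrite !mulrA -exprS /=.
by congr (_ * _ ^+ _); rewrite /bump /= add1n; case: n i {IHn} => [[]|].
Qed.

(** The expansion of D(a^p) by the product rule is a sum of terms L_a^j (D(a) L_a^(p-1-j) 1), which
    [sum_iter_leibniz_pchar] collapses. *)
Lemma derivation_exp_pchar (D : R -> R) (a : R) : D 1 = 0 ->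
  (forall x y, D (x * y) = D x * y + x * D y) ->
  D (a ^+ p) = iter p.-1 (comm a) (D a).
Proof.
move=> D1 DM; have aD : {morph *%R a : x y / x + y} by move=> x y; rewrite mulrDr.
have := sum_iter_leibniz_pchar aD (comm_leibniz a)
  (pcharf_prime charp) (mulrn_pchar charp) (D a) 1.
have E n v : iter n ( *%R a) v = a ^+ n * v.
  by elim: n => [|n IHn]; rewrite ?mul1r //= IHn mulrA -exprS.
rewrite mulr1 => <-; rewrite derivation_exp //; apply: eq_bigr => j _.
by rewrite !E mulr1 mulrA.
Qed.

End CommPchar.

(** * Jacobson's formula deformed by a derivation *)

Section DeformedPower.
Variables (k : fieldType) (A : algType k) (p : nat).
Hypothesis charp : p \in [pchar k].
Variables (D : A -> A).
Hypothesis DD : {morph D : x y / x + y}.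
Hypothesis DM : forall x y, D (x * y) = D x * y + x * D y.

Lemma pchar_alg : p \in [pchar A].
Proof.
rewrite inE (pcharf_prime charp) /= -scaler_nat (pcharf0 charp).
by rewrite scale0r.
Qed.

Let D0 : D 0 = 0. Proof. by apply: (addrI (D 0)); rewrite -DD !addr0. Qed.

(* [ad_tD] with the derivation D added: the coefficients of ad_(tx + y) + D. *)
Definition ad_tD_der (x y : A) (c : nat -> A) : nat -> A :=
  fun n => (if n is m.+1 then comm x (c m) else 0) + (comm y (c n) + D (c n)).

Variables x y : A.
Local Notation P := {poly A}.
(** In A[t], with t central: a is tx + y, E is L_a + D and F is ad_a + D, where D acts on
    coefficients. *)
Let a : P := x%:P * 'X + y%:P.
Let E (q : P) : P := a * q + map_poly D q.
Let F (q : P) : P := comm a q + map_poly D q.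

Let coefa (q : P) n : (a * q)`_n = (if n is m.+1 then x * q`_m else 0) + y * q`_n.
Proof.
rewrite mulrDl coefD coefCM -mulrA coefCM -commr_polyX coefMX.
by case: n => [|n] //=; rewrite mulr0.
Qed.
Let coefar (q : P) n : (q * a)`_n = (if n is m.+1 then q`_m * x else 0) + q`_n * y.
Proof.
by rewrite mulrDr coefD coefMC mulrA coefMX; case: n => [|n] //=; rewrite coefMC.
Qed.
Let coefD_ (q : P) n : (map_poly D q)`_n = D q`_n.
Proof. exact: coef_map_id0. Qed.

Let coefE_ (q : P) n :
  (E q)`_n = (if n is m.+1 then x * q`_m else 0) + (y * q`_n + D q`_n).
Proof. by rewrite /E coefD coefa coefD_ addrA. Qed.
Let coefF (q : P) n : (F q)`_n = ad_tD_der x y (fun i => q`_i) n.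
Proof.
rewrite /F coefD coefB coefa coefar coefD_ /ad_tD_der /comm.
by case: n => [|n]; rewrite opprD addrACA -[LHS]addrA ?subrr.

Qed.

Let DpD : {morph map_poly D : q r / q + r}.
Proof. by move=> q r; apply/polyP => n; rewrite coefD !coefD_ coefD DD. Qed.
Let DpM q r : map_poly D (q * r) = map_poly D q * r + q * map_poly D r.
Proof.
apply/polyP => n; rewrite coefD_ coefD !coefM (big_morph D DD D0) -big_split /=.
by apply: eq_bigr => i _; rewrite DM !coefD_.
Qed.
Let ED : {morph E : q r / q + r}.
Proof. by move=> q r; rewrite /E mulrDr DpD addrACA. Qed.
Let EF b v : E (b * v) = F b * v + b * E v.
Proof.
by rewrite /E /F comm_leibniz DpM [in RHS]mulrDl [in RHS]mulrDr [LHS]addrACA.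
Qed.

Let DMn u n : D (u *+ n) = D u *+ n.
Proof. by elim: n => [|n IHn]; rewrite ?mulr0n // !mulrS DD IHn. Qed.

(** D acts coefficientwise, hence commutes with d/dt; the extra term comes from da/dt = x. *)
Let derivE q : (E q)^`() = E q^`() + x%:P * q.
Proof.
apply/polyP => n; rewrite coefD coef_deriv !coefE_ coefCM !coef_deriv DMn mulrnAr.
case: n => [|n]; first by rewrite !mulr1n add0r addrC.
by rewrite !mulrnDl [RHS]addrAC coef_deriv mulrnAr -mulrSr.
Qed.

(** The derivative falls on one of the n factors E and turns it into L_x. *)
Let deriv_iterE n : (iter n E 1)^`() =
  \sum_(j < n) iter j E (x%:P * iter (n.-1 - j) E 1).
Proof.
elim: n => [|n IHn]; first by rewrite big_ord0 /= derivC.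
rewrite iterS derivE IHn big_ord_recl /= subn0 addrC; congr (_ + _).
have E0 : E 0 = 0 by apply: (addrI (E 0)); rewrite -ED !addr0.
rewrite (big_morph E ED E0); apply: eq_bigr => i _; rewrite -iterS.
by rewrite /bump /= add1n; case: n i {IHn} => [[]|].
Qed.

Let coef_iterE0 n : (iter n E 1)`_0 = iter n (fun v => y * v + D v) 1.
Proof. by elim: n => [|n IHn]; rewrite ?coef1 //= coefE_ IHn add0r. Qed.

Let coef_iterE_gt n m : (n < m)%N -> (iter n E 1)`_m = 0.
Proof.
elim: n m => [|n IHn] [|m] //; first by rewrite coef1.
rewrite ltnS => nm; rewrite /= coefE_ !IHn ?D0 ?mulr0 ?addr0 //.
exact: leqW.
Qed.

Let coef_iterEn n : (iter n E 1)`_n = x ^+ n.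
Proof.
elim: n => [|n IHn]; first by rewrite coef1.
by rewrite /= coefE_ IHn coef_iterE_gt // D0 mulr0 !addr0 exprS.
Qed.

(** The sum is E^n 1 at t = 1, its degree being at most n; there tx + y becomes x + y. *)
Let sum_coef_iterE n m : (n < m)%N ->
  \sum_(i < m) (iter n E 1)`_i = iter n (fun v => (x + y) * v + D v) 1.
Proof.
elim: n m => [|n IHn] [|m] // nm.
  by rewrite big_ord_recl coef1 big1 ?addr0 // => i _; rewrite coef1.
rewrite /=; under eq_bigr do rewrite coefE_.
rewrite big_split /= big_ord_recl add0r -mulr_sumr IHn //.
rewrite big_split /= -mulr_sumr -(big_morph D DD D0) IHn; last exact: ltnW.
by rewrite addrA -mulrDl.
Qed.

Let coef_iterF n i :
  (iter n F x%:P)`_i = iter n (ad_tD_der x y) (fun n => if n == 0%N then x else 0) i.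
Proof.
elim: n i => [|n IHn] i; first by rewrite coefC.
by rewrite !iterS coefF; congr (ad_tD_der x y _ i); apply/funext => j.
Qed.

(* Differentiate (L_(tx + y) + D)^p 1 with respect to t: in characteristic p
   the derivative collapses to (ad_(tx + y) + D)^(p-1) x. *)
Lemma deformed_power :
  iter p (fun v => (x + y) * v + D v) 1 =
  iter p (fun v => y * v + D v) 1 + x ^+ p +
  \sum_(1 <= i < p) (i%:R)^-1 *:
     iter p.-1 (ad_tD_der x y) (fun n => if n == 0%N then x else 0) i.-1.
Proof.
have p0 := prime_gt0 (pcharf_prime charp).
have charP : p \in [pchar {poly A}] by rewrite pchar_poly pchar_alg.
have dE := sum_iter_leibniz_pchar ED EF (pcharf_prime charP) (mulrn_pchar charP) x%:P 1.
rewrite -deriv_iterE mulr1 in dE.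
(* The coefficients of E^p 1 are matched one by one: t^0 gives the term in y, t^p gives x^p, and for
   0 < i < p the i-th is read off the derivative after division by i, which is invertible in k. *)
rewrite -(sum_coef_iterE (ltnSn p)) big_ord_recr /= coef_iterEn.
rewrite [RHS]addrAC; congr (_ + _); rewrite -coef_iterE0.
rewrite -(big_mkord predT (fun i => (iter p E 1)`_i)) [LHS]big_ltn //=.
congr (_ + _).
rewrite !big_nat; apply: eq_bigr => i /andP[i0 ip].
rewrite -coef_iterF -dE coef_deriv prednK // -scaler_nat scalerA mulVf ?scale1r //.
by rewrite -(dvdn_pcharf charp) gtnNdvd.
Qed.

End DeformedPower.

Section Jacobson.
Variables (k : fieldType) (A : algType k) (p : nat).
Hypothesis charp : p \in [pchar k].

Lemma comm_bilinear : is_bilinear (@comm A).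
Proof.
split=> [x a y z|x a y z]; rewrite /comm.
  by rewrite mulrDr mulrDl -scalerAr -scalerAl scalerBr opprD addrACA.
by rewrite mulrDr mulrDl -scalerAr -scalerAl scalerBr opprD addrACA.
Qed.

Lemma comm_jacobi (x y z : A) :
  comm x (comm y z) + comm y (comm z x) + comm z (comm x y) = 0.
Proof.
have E (u v w : A) : comm u (comm v w) =
    (u * v * w - v * w * u) - (u * w * v - w * v * u).
  rewrite /comm !mulrBr !mulrBl !mulrA !opprB addrACA [RHS]addrACA.
  by congr (_ + _); apply: addrC.
have T (a b c : A) : (a - b) + (b - c) + (c - a) = 0.
  by rewrite [a - b + _]addrA subrK addrA subrK subrr.
rewrite !E [X in X + _ = _]addrACA -opprD [LHS]addrACA -opprD T [X in 0 - X]addrAC.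
by rewrite T subr0.
Qed.

Lemma comm_is_lie : is_lie (@comm A).
Proof.
split; [exact: comm_bilinear | by move=> x; rewrite /comm subrr | exact: comm_jacobi].
Qed.

(** The formula for (x + y)^p is [deformed_power] at D = 0, where (L_z)^p 1 = z^p. *)
Lemma assoc_restricted_lie : is_restricted_lie p (@comm A) (fun x => x ^+ p).
Proof.
have charA := pchar_alg A charp.
split; first exact: comm_is_lie.
- by move=> a x; rewrite exprZn.
- by move=> x y; rewrite comm_exp_pchar.
move=> x y.
have DD : {morph (fun _ : A => 0 : A) : u v / u + v} by move=> u v; rewrite /= addr0.
have DM (u v : A) : 0 = 0 * v + u * 0 by rewrite mulr0 mul0r addr0.
have := deformed_power charp DD DM x y.
have Ex n (z : A) : iter n (fun v => z * v + 0) 1 = z ^+ n.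
  by elim: n => //= n ->; rewrite addr0 exprS.
rewrite !Ex => ->; rewrite [in RHS](addrC (x ^+ p)); congr (_ + _).
apply: eq_bigr => i _; congr (_ *: _); congr (iter _ _ _ _).
by apply/funext => c; apply/funext => n; rewrite /ad_tD_der addr0.
Qed.

End Jacobson.

(** * Compositions *)

(** The pairs with i + l <= n are grouped by j = i + l on the left and by l on the right. *)
Lemma sum_triangle (V : nmodType) (H : nat -> nat -> V) n :
  \sum_(j < n.+1) \sum_(i < j.+1) H i (j - i)%N =
  \sum_(l < n.+1) \sum_(i < (n - l).+1) H i l.
Proof.
elim: n => [|n IHn]; first by rewrite !big_ord1.
rewrite big_ord_recr /= IHn [RHS]big_ord_recr /= subnn big_ord1.
have -> : \sum_(l < n.+1) \sum_(i < (n.+1 - l).+1) H i l =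
    \sum_(l < n.+1) \sum_(i < (n - l).+1) H i l + \sum_(l < n.+1) H (n.+1 - l)%N l.
  rewrite -big_split; apply: eq_bigr => l _ /=.
  by rewrite subSn -1?ltnS ?ltn_ord // big_ord_recr.
rewrite -addrA; congr (_ + _).
rewrite (reindex_inj rev_ord_inj) /= [LHS]big_ord_recr /= subnn subn0; congr (_ + _).
by apply: eq_bigr => i _; rewrite subSS subKn // ltnW.
Qed.

(** Both sides are the trinomial coefficient: multiplied by i! l! (n-i-l)! each becomes n!. *)
Lemma bin_trinomial n i l : (i + l <= n)%N ->
  ('C(n, i + l) * 'C(i + l, i) = 'C(n, l) * 'C(n - l, i))%N.
Proof.
move=> iln; have ln : (l <= n)%N by apply: leq_trans iln; apply: leq_addl.
have inl : (i <= n - l)%N by rewrite leq_subRL // addnC.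
apply/eqP; rewrite -(eqn_pmul2r (fact_gt0 i)) -(eqn_pmul2r (fact_gt0 l)).
rewrite -(eqn_pmul2r (fact_gt0 (n - (i + l)))); apply/eqP.
have A := bin_fact iln; have B := bin_fact (leq_addr l i).
have C := bin_fact ln; have D := bin_fact inl.
rewrite addKn in B; rewrite -subnDA (addnC l) in D.
transitivity n`!.
  by rewrite -A -B !mulnA.
rewrite -C -D -!mulnA; congr (_ * _)%N.
by rewrite mulnCA; congr (_ * _)%N; rewrite mulnCA.
Qed.

Section Compositions.
Variables (k : fieldType) (L : lmodType k) (br : L -> L -> L) (D : L -> L) (u : L).
Hypothesis brD : forall x, {morph br x : y z / y + z}.
Hypothesis DD : {morph D : x y / x + y}.
Hypothesis Dbr : forall x y, D (br x y) = br (D x) y + br x (D y).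

(** The operator t ad_u + D on polynomials in t, as coefficient sequences. For a commutator bracket
    it is [ad_tD_der] at x = u, y = 0. *)
Definition ad_D (c : nat -> L) : nat -> L :=
  fun n => (if n is m.+1 then br u (c m) else 0) + D (c n).

(* [comp_sum r n v] is the sum of the C_a [x_a1, [x_a2, .. [x_ar, v]]] over the
   compositions a of n of length r, where x_m = D^(m-1) u; its recursion peels
   off the last part of a. *)
Fixpoint comp_sum (r n : nat) (v : L) : L :=
  if r is s.+1 then
    \sum_(i < n) comp_sum s (n.-1 - i) (br (iter i D u) v) *+ 'C(n.-1, i)
  else if n == 0%N then v else 0.

Lemma comp_sumD r n : {morph comp_sum r n : v w / v + w}.
Proof.
elim: r n => [|r IHr] n v w /=; first by case: eqP; rewrite ?addr0.
by rewrite -big_split; apply: eq_bigr => i _ /=; rewrite brD IHr mulrnDl.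
Qed.

Lemma comp_sum0 r n : comp_sum r n 0 = 0.
Proof. by apply: (addrI (comp_sum r n 0)); rewrite -comp_sumD !addr0. Qed.

(** Peeling off the last part on the left, and applying Leibniz to D^j [u, v] on the right, gives
    the same sum over i + l <= n with trinomial coefficients. *)
Lemma comp_sumS_binomial r n v :
  \sum_(l < n.+1) comp_sum r.+1 (n.+1 - l) (iter l D v) *+ 'C(n, l) =
  \sum_(j < n.+1) comp_sum r (n - j) (iter j D (br u v)) *+ 'C(n, j).
Proof.
pose H i l := comp_sum r (n - (i + l)) (br (iter i D u) (iter l D v))
                *+ ('C(n, l) * 'C(n - l, i)).
transitivity (\sum_(l < n.+1) \sum_(i < (n - l).+1) H i l).
  apply: eq_bigr => l _; rewrite subSn; last by rewrite -ltnS ltn_ord.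
  rewrite -sumrMnl; apply: eq_bigr => i _ /=.
  by rewrite -mulrnA mulnC -subnDA addnC.
rewrite -sum_triangle; apply: eq_bigr => j _.
rewrite (iter_leibniz DD Dbr) (big_morph _ (comp_sumD r (n - j)) (comp_sum0 r (n - j))).
rewrite -sumrMnl; apply: eq_bigr => i _.
have ij : (i <= j)%N by rewrite -ltnS.
have E : (i + (j - i) = j)%N by rewrite subnKC.
have cMn m w : comp_sum r (n - j) (w *+ m) = comp_sum r (n - j) w *+ m.
  elim: m => [|m IHm]; first exact: comp_sum0.
  by rewrite !mulrS comp_sumD IHm.
rewrite /H -bin_trinomial E ?cMn -?mulrnA; last by rewrite -ltnS.
by rewrite mulnC.
Qed.

Definition single (v : L) : nat -> L := fun n => if n == 0%N then v else 0.

(** The induction applies one factor to v first, (t ad_u + D) v = t [u, v] + D v, so v has to be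
    arbitrary; [shift] is multiplication by t. *)
Lemma iter_ad_D n v r : iter n ad_D (single v) r =
  \sum_(j < n.+1) comp_sum r (n - j) (iter j D v) *+ 'C(n, j).
Proof.
have br0 x : br x 0 = 0 by apply: (addrI (br x 0)); rewrite -brD !addr0.
have D0 : D 0 = 0 by apply: (addrI (D 0)); rewrite -DD !addr0.
have addI m c d r' : iter m ad_D (fun i => c i + d i) r' =
    iter m ad_D c r' + iter m ad_D d r'.
  elim: m r' => [//|m IHm] r'; rewrite !iterS {1}/ad_D IHm DD.
  by rewrite /ad_D; case: r' => [|r']; rewrite ?IHm ?brD ?addr0 ?add0r // addrACA.
pose shift (c : nat -> L) i := if i is m.+1 then c m else 0.
have shiftI m c r' : iter m ad_D (shift c) r' = shift (iter m ad_D c) r'.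
  elim: m r' => [//|m IHm] r'; rewrite !iterS {1}/ad_D IHm.
  case: r' => [|[|r']] /=; rewrite ?IHm /= ?D0 ?br0 ?add0r ?addr0 //.
  by rewrite /ad_D add0r.
elim: n v r => [|n IHn] v r.
  by rewrite big_ord1 /= bin0; case: r => //= r; rewrite big_ord0.
rewrite iterSr.
have -> : ad_D (single v) = fun i => shift (single (br u v)) i + single (D v) i.
  by apply/funext => -[|[|i]]; rewrite /ad_D /single /= ?D0 ?br0.
rewrite addI shiftI IHn [RHS]big_ord_recl bin0 subn0 /=.
have -> : \sum_(i < n.+1) comp_sum r (n.+1 - bump 0 i) (iter (bump 0 i) D v)
      *+ 'C(n.+1, bump 0 i) =
    \sum_(i < n.+1) comp_sum r (n - i) (iter i.+1 D v) *+ 'C(n, i.+1) +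
    \sum_(i < n.+1) comp_sum r (n - i) (iter i.+1 D v) *+ 'C(n, i).
  rewrite -big_split; apply: eq_bigr => i _ /=.
  by rewrite /bump /= add1n subSS binS mulrnDr.
rewrite addrA; congr (_ + _); last by apply: eq_bigr => i _; rewrite -iterSr.
(* Pascal's rule has split off the part belonging to D v. What remains is the part of t [u, v], by
   [comp_sumS_binomial]; at r = 0 it vanishes because n + 1 - l > 0. *)
transitivity (\sum_(l < n.+1) comp_sum r (n.+1 - l) (iter l D v) *+ 'C(n, l)).
  case: r => [|r]; last by rewrite comp_sumS_binomial /= IHn.
  by rewrite big1 // => l _; rewrite subSn -1?ltnS ?ltn_ord //= mul0rn.
rewrite big_ord_recl bin0 subn0 /=; congr (_ + _).
rewrite [RHS]big_ord_recr /= bin_small // mulr0n addr0.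
by apply: eq_bigr => i _; rewrite /bump /= add1n subSS.
Qed.


Definition is_comp (n : nat) (a : seq nat) := all (leq 1) a && (sumn a == n).

Lemma comp_coef_rcons a m :
  comp_coef (rcons a m) = (comp_coef a * 'C((sumn a + m).-1, m.-1))%N.
Proof.
rewrite /comp_coef size_rcons big_ord_recr /=; congr (_ * 'C(_, _))%N.
- apply: eq_bigr => j _; rewrite nth_rcons ltn_ord -cats1 takel_cat //.
- by rewrite -(size_rcons a m) take_size sumn_rcons.
- by rewrite nth_rcons ltnn eqxx.
Qed.

Lemma is_comp_rcons n a m :
  is_comp n (rcons a m) = (0 < m <= n)%N && is_comp (n - m) a.
Proof.
rewrite /is_comp all_rcons sumn_rcons -andbA -andbA; congr (_ && _).
have [mn|mn] := leqP m n; first by rewrite -{1}(subnK mn) eqn_add2r.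
by rewrite andbC; case: eqP => // E; move: mn; rewrite -E ltnNge leq_addl.
Qed.

(** The last part is i+1. The bound N makes the type of parts finite; all parts are at most n <
    N. *)
Lemma sum_comp_rcons (V : nmodType) (G : seq nat -> V) r n N : (n < N)%N ->
  \sum_(a : r.+1.-tuple 'I_N | is_comp n (map val a)) G (map val a) =
  \sum_(i < n) \sum_(a : r.-tuple 'I_N | is_comp (n.-1 - i) (map val a))
     G (rcons (map val a) i.+1).
Proof.
move=> nN.
pose h (am : r.-tuple 'I_N * 'I_N) := [tuple of rcons am.1 am.2].
have h_bij : bijective h.
  apply: inj_card_bij => [[a m] [b l] /(congr1 val) /= /rcons_inj[ab ->]|].
    by congr (_, _); apply/val_inj.
  by rewrite card_prod !card_tuple expnSr.
rewrite (reindex h) /=; last exact: onW_bij.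
under eq_bigl do rewrite map_rcons is_comp_rcons.
under eq_bigr do rewrite map_rcons.
rewrite (eq_bigl (fun am : r.-tuple 'I_N * 'I_N =>
  predT am.1 && ((0 < am.2 <= n)%N && is_comp (n - am.2) (map val am.1)))) //.
rewrite -(pair_big_dep predT (fun (a : r.-tuple 'I_N) (m : 'I_N) =>
  (0 < m <= n)%N && is_comp (n - m) (map val a))
  (fun a m => G (rcons (map val a) (val m)))) /=.
rewrite (exchange_big_dep (fun m : 'I_N => (0 < m <= n)%N)) /=; last first.
  by move=> a m _ /andP[].
pose S m := \sum_(a : r.-tuple 'I_N | is_comp (n - m) (map val a))
     G (rcons (map val a) m).
transitivity (\sum_(m < N | (0 < m <= n)%N) S m).
  by apply: eq_bigr => m mn; apply: eq_bigl => a; rewrite mn.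
rewrite -(big_mkord (fun m => 0 < m <= n)%N S).
transitivity (\sum_(1 <= m < n.+1) S m); last first.
  rewrite big_add1 big_mkord; apply: eq_bigr => i _; apply: eq_bigl => a.
  by congr (is_comp _ _); case: (n) i => [[]|].
rewrite [RHS](big_nat_widen _ _ N) //.
rewrite big_ltn_cond /=; last exact: leq_trans nN.
rewrite big_nat_cond [RHS]big_nat_cond; apply: eq_bigl => m.
by rewrite ltnS; case: m.
Qed.

(** Removing the last part i+1 from a composition of n removes the factor C(n-1, i) from C_a, which
    is the coefficient in the recursion of [comp_sum]. *)
Lemma comp_sumE r n N v : (n < N)%N -> comp_sum r n v =
  \sum_(a : r.-tuple 'I_N | is_comp n (map val a))
    foldr (fun m w => br (iter m.-1 D u) w) v (map val a) *+ comp_coef (map val a).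
Proof.
elim: r n v => [|r IHr] n v nN /=.
  have E0 (a : 0.-tuple 'I_N) : map val a = [::] by rewrite tuple0.
  case: eqP => [->|n0].
    rewrite (big_pred1 [tuple]) => [|a]; last by rewrite E0 [a]tuple0 [RHS]eqxx.
    by rewrite E0 /comp_coef big_ord0.
  by rewrite big_pred0 // => a; rewrite E0 /is_comp /=; case: eqP => // /esym.
rewrite (sum_comp_rcons (fun a =>
  foldr (fun m w => br (iter m.-1 D u) w) v a *+ comp_coef a)) //.
apply: eq_bigr => i _; rewrite (IHr (n.-1 - i)%N); last first.
  by apply: leq_ltn_trans nN; rewrite (leq_trans (leq_subr _ _)) ?leq_pred.
rewrite -sumrMnl; apply: eq_bigr => a /andP[_ /eqP asum].
rewrite comp_coef_rcons asum -cats1 foldr_cat /= mulrnA.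
by rewrite addnS /= subnK // -ltnS prednK ?(leq_ltn_trans _ (ltn_ord i)).
Qed.

(** At v = u in [iter_ad_D], D^j u stands for a last part j+1 and C(n-1, j) is its factor in C_a;
    hence the shifts by one on the left. *)
Lemma iter_ad_D_comp r n N : (0 < r)%N -> (0 < n < N)%N ->
  iter n.-1 ad_D (single u) r.-1 =
  \sum_(a : r.-tuple 'I_N | is_comp n (map val a))
    nested_br br [seq iter m.-1 D u | m <- map val a] *+ comp_coef (map val a).
Proof.
case: r => // r _; case: n => // n /= nN; rewrite iter_ad_D.
rewrite (sum_comp_rcons (fun a =>
  nested_br br [seq iter m.-1 D u | m <- a] *+ comp_coef a)) //.
apply: eq_bigr => i _; rewrite (comp_sumE r (N := N)); last first.
  by apply: leq_ltn_trans (ltnW nN); rewrite leq_subr.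
rewrite -sumrMnl; apply: eq_bigr => a /andP[_ /eqP asum].
rewrite comp_coef_rcons asum mulrnA map_rcons /=.
congr (_ *+ _ *+ 'C(_, _)); last by rewrite addnS /= subnK // -ltnS.
by elim: (map val a) => //= m [|m' b] -> //.
Qed.

End Compositions.

Section SubadjacentPower.
Variables (k : fieldType) (A : algType k) (p : nat).
Hypothesis charp : p \in [pchar k].

(** This is [deformed_power] with x = u and y = 0: the term in y vanishes because D 1 = 0 and p > 0,
    and [iter_ad_D_comp] with N = p+1, the bound in [subadj_pmap], gives the other coefficients. *)
Lemma subadj_pmap_assoc (rhd : A -> A -> A) (u : A) :
  {morph rhd u : x y / x + y} ->
  (forall x y, rhd u (x * y) = rhd u x * y + x * rhd u y) ->
  iter p (fun v => u * v + rhd u v) 1 =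
  subadj_pmap p (@comm A) (fun x => x ^+ p) rhd u.
Proof.
move=> DD DM; have p0 := prime_gt0 (pcharf_prime charp).
have := deformed_power charp DD DM u 0; rewrite addr0 => ->.
have D1 : rhd u 1 = 0.
  by apply: (addrI (rhd u 1)); rewrite addr0 -{3}[1]mulr1 DM mulr1 mul1r.
have D0 : rhd u 0 = 0 by apply: (addrI (rhd u 0)); rewrite -DD !addr0.
have -> : iter p (fun v => 0 * v + rhd u v) 1 = 0.
  have E0 : (fun v => 0 * v + rhd u v) = rhd u.
    by apply/funext => v; rewrite mul0r add0r.
  by rewrite E0 -(prednK p0) iterSr D1; elim: (p.-1) => //= n ->.
rewrite add0r /subadj_pmap; congr (_ + _).
have cD (x : A) : {morph comm x : y z / y + z}.
  by move=> y z; rewrite /comm mulrDr mulrDl opprD addrACA.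
have Dc x y : rhd u (comm x y) = comm (rhd u x) y + comm x (rhd u y).
  have DN z : rhd u (- z) = - rhd u z.
    by apply: (addrI (rhd u z)); rewrite -DD !subrr.
  by rewrite /comm DD DN !DM [in RHS]addrACA -opprD [X in _ - X = _]addrC.
rewrite !big_nat; apply: eq_bigr => r /andP[r0 rp]; congr (_ *: _).
transitivity (iter p.-1 (ad_D (@comm A) (rhd u) u) (single u) r.-1).
  congr (iter _ _ _ _); apply/funext => c; apply/funext => n.
  by rewrite /ad_tD_der /ad_D /comm mul0r mulr0 subrr add0r.
rewrite (iter_ad_D_comp u cD DD Dc (N := p.+1)) ?p0 //=.
by apply: eq_bigr => a _; rewrite scaler_nat.
Qed.

End SubadjacentPower.

(** * The Poincare-Birkhoff-Witt module *)

Section LinearEndomorphisms.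
Variables (k : fieldType) (V : lmodType k).

Record lend := Lend { lend_fun : V -> V; lendP : linear lend_fun }.
HB.instance Definition _ := gen_eqMixin lend.
HB.instance Definition _ := gen_choiceMixin lend.

Lemma lend_eq (f g : lend) : (forall v, lend_fun f v = lend_fun g v) -> f = g.
Proof.
case: f g => [f fP] [g gP] /= /funext E; case: g / E gP => gP.
by congr Lend; apply: Prop_irrelevance.
Qed.

Fact lend_zero_linear : linear (fun _ : V => 0 : V).
Proof. by move=> a u v; rewrite scaler0 addr0. Qed.
Fact lend_add_linear (f g : lend) : linear (fun v => lend_fun f v + lend_fun g v).
Proof. by move=> a u v; rewrite !lendP scalerDr addrACA. Qed.
Fact lend_opp_linear (f : lend) : linear (fun v => - lend_fun f v).
Proof. by move=> a u v; rewrite lendP opprD scalerN. Qed.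
Fact lend_scale_linear (c : k) (f : lend) : linear (fun v => c *: lend_fun f v).
Proof. by move=> a u v; rewrite lendP scalerDr !scalerA mulrC. Qed.
Fact lend_one_linear : linear (fun v : V => v).
Proof. by []. Qed.
Fact lend_mul_linear (f g : lend) : linear (fun v => lend_fun f (lend_fun g v)).
Proof. by move=> a u v; rewrite !lendP. Qed.

Definition lend_zero := Lend lend_zero_linear.
Definition lend_add f g := Lend (lend_add_linear f g).
Definition lend_opp f := Lend (lend_opp_linear f).
Definition lend_scale c f := Lend (lend_scale_linear c f).
Definition lend_one := Lend lend_one_linear.
Definition lend_mul f g := Lend (lend_mul_linear f g).

Fact lend_addA : associative lend_add.
Proof. by move=> f g h; apply: lend_eq => v /=; rewrite addrA. Qed.
Fact lend_addC : commutative lend_add.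
Proof. by move=> f g; apply: lend_eq => v /=; rewrite addrC. Qed.
Fact lend_add0 : left_id lend_zero lend_add.
Proof. by move=> f; apply: lend_eq => v /=; rewrite add0r. Qed.
Fact lend_addN : left_inverse lend_zero lend_opp lend_add.
Proof. by move=> f; apply: lend_eq => v /=; rewrite addNr. Qed.
HB.instance Definition _ := GRing.isZmodule.Build lend
  lend_addA lend_addC lend_add0 lend_addN.

Fact lend_scaleA a b f : lend_scale a (lend_scale b f) = lend_scale (a * b) f.
Proof. by apply: lend_eq => v /=; rewrite scalerA. Qed.
Fact lend_scale1 : left_id 1 lend_scale.
Proof. by move=> f; apply: lend_eq => v /=; rewrite scale1r. Qed.
Fact lend_scaleDr : right_distributive lend_scale +%R.
Proof. by move=> a f g; apply: lend_eq => v /=; rewrite scalerDr. Qed.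
Fact lend_scaleDl f : {morph lend_scale^~ f : a b / a + b}.
Proof. by move=> a b; apply: lend_eq => v /=; rewrite scalerDl. Qed.
HB.instance Definition _ := GRing.Zmodule_isLmodule.Build k lend
  lend_scaleA lend_scale1 lend_scaleDr lend_scaleDl.

Fact lend_mulA : associative lend_mul.
Proof. by move=> f g h; apply: lend_eq. Qed.
Fact lend_mul1 : left_id lend_one lend_mul.
Proof. by move=> f; apply: lend_eq. Qed.
Fact lend_1mul : right_id lend_one lend_mul.
Proof. by move=> f; apply: lend_eq. Qed.
Fact lend_mulDl : left_distributive lend_mul +%R.
Proof. by move=> f g h; apply: lend_eq. Qed.
Fact lend_mulDr : right_distributive lend_mul +%R.
Proof.
move=> f g h; apply: lend_eq => v /=.
by rewrite -[X in lend_fun f (X + _)]scale1r lendP scale1r.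
Qed.
HB.instance Definition _ := GRing.Zmodule_isPzRing.Build lend
  lend_mulA lend_mul1 lend_1mul lend_mulDl lend_mulDr.

Fact lend_mulZl a (f g : lend) : a *: (f * g) = (a *: f) * g.
Proof. by apply: lend_eq. Qed.
Fact lend_mulZr a (f g : lend) : a *: (f * g) = f * (a *: g).
Proof.
apply: lend_eq => v /=; have := lendP f a (lend_fun g v) 0.
have f0 : lend_fun f 0 = 0.
  by have := lendP f (-1) 0 0; rewrite scaler0 addr0 scaleN1r addNr.
by rewrite f0 !addr0.
Qed.

(** Representations of g on V become algebra morphisms into this algebra through [uea_lift]. V is
    nonzero because an [algType] has 1 != 0. *)
Lemma linear_endo_algebra : (exists v : V, v != 0) ->
  {A : algType k & {app : A -> V -> V | [/\ is_bilinear app,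
     forall v, app 1 v = v, forall a b v, app (a * b) v = app a (app b v),
     injective app &
     forall f : V -> V, linear f -> exists a, app a = f]}}.
Proof.
move=> nzV.
have nz : (1 : lend) != 0.
  have [v v0] := nzV; apply: contraNneq v0 => E.
  by rewrite -[v]/(lend_fun 1 v) E.
pose m0 := GRing.PzSemiRing_isNonZero.Build lend nz.
pose T0 : nzRingType := HB.pack lend m0.
pose m1 := GRing.LSemiModule_isLSemiAlgebra.Build k T0 lend_mulZl.
pose T1 : lalgType k := HB.pack lend m0 m1.
pose m2 := GRing.LSemiAlgebra_isSemiAlgebra.Build k T1 lend_mulZr.
pose T2 : algType k := HB.pack lend m0 m1 m2.
exists T2; exists lend_fun; split=> [|//|//||].
  by split=> [f|v]; [apply: lendP | move=> a f g].
  by move=> f g fg; apply: lend_eq => v; rewrite fg.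
by move=> f fL; exists (Lend fL).
Qed.

End LinearEndomorphisms.

(** * Spans, submodules and linear maps *)

Variant lspan (k : fieldType) (V : lmodType k) (E : V -> Prop) (x : V) : Prop :=
  LSpan of forall S : V -> Prop, is_submodule S -> (forall y, E y -> S y) -> S x.

Section Submodule.
Variables (k : fieldType) (V : lmodType k).

Lemma lspan_submodule (E : V -> Prop) : is_submodule (lspan E).
Proof.
split=> [|a x y [Ex] [Ey]]; split=> S Ssub SE; first by case: Ssub.
by case: (Ssub) => _ SD; apply: SD; [apply: Ex | apply: Ey].
Qed.

Lemma lspan_gen (E : V -> Prop) x : E x -> lspan E x.
Proof. by move=> Ex; split=> S _; apply. Qed.

Variable S : V -> Prop.
Hypothesis Ssub : is_submodule S.

Lemma lspan_min (E : V -> Prop) : (forall y, E y -> S y) -> forall x, lspan E x -> S x.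
Proof. by move=> ES x [Ex]; apply: Ex. Qed.

Lemma submodule0 : S 0. Proof. by case: Ssub. Qed.
Lemma submoduleD x y : S x -> S y -> S (x + y).
Proof. by case: Ssub => _ SD Sx Sy; rewrite -[x]scale1r; apply: SD. Qed.
Lemma submoduleZ a x : S x -> S (a *: x).
Proof. by case: Ssub => S0 SD Sx; rewrite -[_ *: _]addr0; apply: SD. Qed.
Lemma submoduleN x : S x -> S (- x).
Proof. by rewrite -scaleN1r; apply: submoduleZ. Qed.
Lemma submodule_sum (I : eqType) (r : seq I) (F : I -> V) :
  (forall i, i \in r -> S (F i)) -> S (\sum_(i <- r) F i).
Proof.
move=> SF; rewrite big_seq; elim/big_rec: _ => [|i x ir]; first exact: submodule0.
by apply: submoduleD; apply: SF.
Qed.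

End Submodule.

Section LinearMaps.
Variables (k : fieldType) (V W : lmodType k) (f : V -> W).
Hypothesis fL : linear f.

Lemma lin0 : f 0 = 0.
Proof. by have := fL (-1) 0 0; rewrite scaler0 addr0 scaleN1r addNr. Qed.
Lemma linD : {morph f : x y / x + y}.
Proof. by move=> x y; have := fL 1 x y; rewrite !scale1r. Qed.
Lemma linZ a : {morph f : x / a *: x}.
Proof. by move=> x; have := fL a x 0; rewrite lin0 !addr0. Qed.
Lemma linN : {morph f : x / - x}.
Proof. by move=> x; rewrite -!scaleN1r linZ. Qed.
Lemma linB : {morph f : x y / x - y}.
Proof. by move=> x y; rewrite linD linN. Qed.
Lemma lin_sum (I : Type) (r : seq I) (P : pred I) (F : I -> V) :
  f (\sum_(i <- r | P i) F i) = \sum_(i <- r | P i) f (F i).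
Proof. exact: (big_morph f linD lin0). Qed.

End LinearMaps.

Lemma lie_anti (k : fieldType) (g : lmodType k) (br : g -> g -> g) :
  is_lie br -> forall i j, br i j = - br j i.
Proof.
case=> [[bR bL] alt _] i j; apply/eqP; rewrite -addr_eq0; apply/eqP.
have := alt (i + j); rewrite (linD (bR _)) (linD (bL i)) (linD (bL j)) /= !alt.
by rewrite add0r addr0 addrC.
Qed.

(** * A basis with a total order *)

Section OrderedBasis.
Variables (k : fieldType) (g : lmodType k).

(* The basis is encoded by its coordinate map: it consists of the b whose
   coordinate vector is b itself. *)
Lemma ordered_basis : exists (R : rel g) (coord : g -> {malg k[g]}),
  [/\ total R, transitive R, antisymmetric R & [/\ linear coord,
   forall x, malg_lin id (coord x) = x &
   forall x, lspan (fun c : {malg k[g]} =>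
     exists2 b, coord b = << 1 *g b >> & c = << 1 *g b >>) (coord x)]].
Proof.
have [R Rwo] := well_ordering_principle g.
have Rchain : wo_chain R predT by move=> A _; apply: Rwo.
have Rtot : total R by move=> x y; apply: (wo_chainW Rchain).
have Ranti : antisymmetric R by move=> x y; apply: (wo_chain_antisymmetric Rchain).
have Rrefl x : R x x by apply: (wo_chain_reflexive Rchain).
have Rtr : transitive R.
  move=> y x z Rxy Ryz.
  (* The least of x, y, z decides: if it is not x, antisymmetry identifies two neighbours. *)
  have [|m [[]]] := Rwo (mem [:: x; y; z]); first by exists x; apply: mem_head.
  rewrite !inE => /or3P[]/eqP-> lb _.
  - by apply: lb; rewrite !inE eqxx !orbT.
  - have Ryx : R y x by apply: lb; rewrite !inE eqxx.
    by rewrite (Ranti x y) // Rxy Ryx.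
  - have Rzy : R z y by apply: lb; rewrite !inE eqxx !orbT.
    by rewrite -(Ranti y z) // Ryz Rzy.
(* The greedy basis: the elements that are not in the span of strictly smaller ones. *)
pose B x := ~ lspan (fun y => R y x /\ y <> x) x.
pose inB (c : {malg k[g]}) := forall b, c@_b <> 0 -> B b.
have inB_sub : is_submodule inB.
  split=> [b|a c d cB dB b]; first by rewrite mcoeff0.
  rewrite mcoeffD mcoeffZ => nz; have [d0|/eqP/dB//] := eqVneq d@_b 0.
  by apply: cB => c0; apply: nz; rewrite c0 d0 mulr0 addr0.
have inBU b : B b -> inB << 1 *g b >>.
  move=> Bb b'; rewrite mcoeffU; case: eqP => [<- //|_].
  by rewrite mulr0n.
have ex x : exists c, inB c /\ malg_lin id c = x.
  (* Spanning: the least m that is no combination of B is not in B, so it is in the span of smaller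
     elements, and these are combinations of B by minimality. *)
  pose N := fun x => `[< ~ exists c, inB c /\ malg_lin id c = x >].
  apply: contrapT => nx.
  have [|m [[/asboolP Nm lb] _]] := Rwo N; first by exists x; apply/asboolP.
  apply: Nm; have [Bm|/contrapT span_m] := pselect (B m).
    by exists << 1 *g m >>; split; [apply: inBU | rewrite malg_linU scale1r].
  case: span_m => /(_ (fun v => exists c, inB c /\ malg_lin id c = v)); apply.
    split=> [|a u v [c [cB <-]] [d [dB <-]]].
      by exists 0; split; [apply: (submodule0 inB_sub) | apply: malg_lin0].
    exists (a *: c + d); rewrite malg_lin_linear; split=> //.
    by case: inB_sub => _; apply.
  move=> y [Rym ym]; apply: contrapT => Ny; apply: ym.
  by apply: Ranti; rewrite Rym lb //; apply/asboolP.
have inj c : inB c -> malg_lin id c = 0 -> c = 0.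
  move=> cB c0; apply/malgP => x; rewrite mcoeff0; apply: mcoeff_outdom; move: x.
  move=> x0; apply/negP => x0c.
  (* Independence: the reversed order puts the largest element m of the support first, and the
     relation expresses m through smaller ones, against m in B. *)
  pose Rop x y := R y x.
  have Rop_tot : total Rop by move=> x y; rewrite /Rop orbC; apply: Rtot.
  have Rop_tr : transitive Rop by move=> y x z /= Ryx Rzy; apply: Rtr Rzy Ryx.
  move: c0; rewrite malg_linE -(perm_big _ (permEl (perm_sort Rop _))) /=.
  have := sort_sorted Rop_tot (msupp c).
  have : uniq (sort Rop (msupp c)) by rewrite sort_uniq fset_uniq.
  have mem_s x : (x \in sort Rop (msupp c)) = (x \in msupp c) by rewrite mem_sort.
  case: (sort Rop (msupp c)) mem_s => [|m s] mem_s.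
    by move: x0c; rewrite -mem_s.
  rewrite cons_uniq => /andP[ms _] /(order_path_min Rop_tr)/allP le_m.
  rewrite big_cons => c0.
  have cm : c@_m != 0 by rewrite mcoeff_neq0 -mem_s mem_head.
  have Bm : B m by apply: cB; apply/eqP.
  have Em : m = - ((c@_m)^-1 *: \sum_(x <- s) c@_x *: x).
    have -> : \sum_(x <- s) c@_x *: x = - (c@_m *: m).
      by apply/eqP; rewrite -addr_eq0 addrC c0.
    by rewrite scalerN opprK scalerA mulVf // scale1r.
  have sp := lspan_submodule (fun y => R y m /\ y <> m).
  apply: Bm; rewrite [X in lspan _ X]Em; apply: (submoduleN sp).
  apply: (submoduleZ sp); apply: (submodule_sum sp) => x xs.
  apply: (submoduleZ sp); apply: lspan_gen; split; first exact: le_m.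
  by move=> xm; rewrite -xm xs in ms.
have [coord coordP] := choice ex.
have coordB x : inB (coord x) by case: (coordP x).
have coordK x : malg_lin id (coord x) = x by case: (coordP x).
(* Uniqueness of expansions makes [coord] linear and fixes its value on basis elements. *)
have uniq c x : inB c -> malg_lin id c = x -> coord x = c.
  move=> cB cx; apply/eqP; rewrite -subr_eq0; apply/eqP/inj.
    by apply: (submoduleD inB_sub) => //; apply: (submoduleN inB_sub).
  by rewrite malg_linB coordK cx subrr.
exists R, coord; split=> //; split=> // [a x y|x].
  apply: uniq; last by rewrite malg_lin_linear !coordK.
  by case: inB_sub => _; apply.
have sp := lspan_submodule
  (fun c : {malg k[g]} => exists2 b, coord b = << 1 *g b >> & c = << 1 *g b >>).
rewrite [coord x]monalgE; apply: (submodule_sum sp) => m mx.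
have -> : << (coord x)@_m *g m >> = (coord x)@_m *: << 1 *g m >>.
  by apply/malgP => n; rewrite mcoeffZ !mcoeffU mulr_natr.
apply: (submoduleZ sp); apply: lspan_gen; exists m => //; apply: uniq.
  by apply: inBU; apply: (coordB x); apply/eqP; rewrite mcoeff_neq0.
by rewrite malg_linU scale1r.
Qed.

End OrderedBasis.

(** The cancellation that ends [rho_rel_low]. *)
Lemma telescope6 (V : zmodType) (A A' X Y P Q Q' S : V) :
  A - A' = X + Y -> Y + Q - Q' = 0 -> P + A + (Q + S) - (S + A' + (Q' + P)) = X.
Proof.
move=> /eqP; rewrite subr_eq => /eqP -> /eqP; rewrite subr_eq add0r => /eqP <-.
by apply/eqP; rewrite subr_eq !addrA (ACl (2*6*4*3*5*1)).
Qed.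

(** * The action of g on words *)

Section PBWModule.
Variables (k : fieldType) (g : lmodType k) (br : g -> g -> g).
Hypothesis br_lie : is_lie br.
Variables (R : rel g) (coord : g -> {malg k[g]}).
Hypothesis Rtot : total R.
Hypothesis Rtr : transitive R.
Hypothesis Ranti : antisymmetric R.
Hypothesis coordL : linear coord.
Hypothesis coordK : forall x, malg_lin id (coord x) = x.

Local Notation M := {malg k[seq g]}.
Local Notation "[ w ]" := (<< 1 *g w >> : M).

Definition mon_ins (i : g) (w : seq g) : M := [sort R (i :: w)].

(* The action of i on the sorted word w is [mon_ins i w] plus the correction
   [act_low n i w], which has degree at most size w; n is a recursion bound and
   any n >= size w gives the same value. *)
Fixpoint act_low (n : nat) (i : g) (w : seq g) : M :=
  match n, w with
  | m.+1, j :: w' =>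
      if R i j then 0 else
      malg_lin (fun v => mon_ins j v + act_low m j v) (act_low m i w') +
      malg_lin (fun l => mon_ins l w' + act_low m l w') (coord (br i j))
  | _, _ => 0
  end.

Lemma act_low_nil n i : act_low n i [::] = 0.
Proof. by case: n. Qed.

Lemma act_low_min n i j w : R i j -> act_low n i (j :: w) = 0.
Proof. by case: n => //= n ->. Qed.

Lemma act_lowS n i j w : ~~ R i j -> act_low n.+1 i (j :: w) =
  malg_lin (fun v => mon_ins j v + act_low n j v) (act_low n i w) +
  malg_lin (fun l => mon_ins l w + act_low n l w) (coord (br i j)).
Proof. by move=> /negbTE /= ->. Qed.

Local Opaque act_low.

(** Defined on all words, but depending only on the sorted rearrangement, so that relations can be
    checked on sorted words. *)
Definition act (i : g) (w : seq g) : M :=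
  mon_ins i w + act_low (size w) i (sort R w).
(** [rho] treats an element of g as one letter and is not linear in it; [rhoX] expands it in the
    basis first and is the representation of g. *)
Definition rho (i : g) : M -> M := malg_lin (act i).
Definition rhoX (x : g) (m : M) : M := malg_lin (fun l => rho l m) (coord x).

Definition low (n : nat) : M -> Prop :=
  lspan (fun m : M => exists w, [/\ sorted R w, (size w <= n)%N & m = [w]]).

Lemma low_submodule n : is_submodule (low n).
Proof. exact: lspan_submodule. Qed.

Lemma lowU n w : sorted R w -> (size w <= n)%N -> low n [w].
Proof. by move=> ws wn; apply: lspan_gen; exists w. Qed.

Lemma low_sub n m t : low n t -> (n <= m)%N -> low m t.
Proof.
move=> tn nm; apply: lspan_min tn; first exact: low_submodule.
by move=> _ [w [ws wn ->]]; apply: lowU => //; apply: leq_trans nm.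
Qed.

Lemma malg_lin_submodule (K : choiceType) (V : lmodType k) (S : V -> Prop)
    (h : K -> V) t : is_submodule S -> (forall w, S (h w)) -> S (malg_lin h t).
Proof.
move=> Ssub Sh; rewrite malg_linE; apply: (submodule_sum Ssub) => w _.
exact: (submoduleZ Ssub).
Qed.

Lemma malg_lin_low (V : lmodType k) (S : V -> Prop) (h : seq g -> V) n t :
  is_submodule S -> (forall w, sorted R w -> (size w <= n)%N -> S (h w)) ->
  low n t -> S (malg_lin h t).
Proof.
move=> Ssub Sh; apply: (@lspan_min _ _ (fun t => S (malg_lin h t))).
  split=> [|a u v Su Sv]; first by rewrite malg_lin0; apply: submodule0.
  by rewrite malg_lin_linear; case: Ssub => _; apply.
by move=> _ [w [ws wn ->]]; rewrite malg_linU scale1r; apply: Sh.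
Qed.

Lemma malg_lin_eq_low (V : lmodType k) (h h' : seq g -> V) n t :
  (forall w, sorted R w -> (size w <= n)%N -> h w = h' w) ->
  low n t -> malg_lin h t = malg_lin h' t.
Proof.
move=> hh'; apply: (@lspan_min _ _ (fun t => malg_lin h t = malg_lin h' t)).
  split=> [|a u v Eu Ev]; first by rewrite !malg_lin0.
  by rewrite !malg_lin_linear Eu Ev.
by move=> _ [w [ws wn ->]]; rewrite !malg_linU hh'.
Qed.

Lemma mon_ins_low i w : low (size w).+1 (mon_ins i w).
Proof. by apply: lowU; rewrite ?sort_sorted // size_sort. Qed.

Lemma act_low_low n i w : sorted R w -> low (size w) (act_low n i w).
Proof.
have lowS := low_submodule.
elim: n i w => [|n IHn] i [|j w] ws; rewrite ?act_low_nil;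
  try exact: (submodule0 (lowS _)).
have ws' : sorted R w by apply: path_sorted ws.
have [ij|ij] := boolP (R i j).
  by rewrite act_low_min //; apply: (submodule0 (lowS _)).
rewrite act_lowS //; apply: (submoduleD (lowS _)).
  apply: malg_lin_low (IHn i w ws'); first exact: lowS.
  move=> v vs vw; apply: (submoduleD (lowS _)).
    by apply: low_sub (mon_ins_low j v) _; rewrite /= ltnS.
  by apply: low_sub (IHn j v vs) _; apply: leqW.
apply: malg_lin_submodule; first exact: lowS.
move=> l; apply: (submoduleD (lowS _)); first exact: mon_ins_low.
by apply: low_sub (IHn l w ws') _; apply: leqnSn.
Qed.

(** By [act_low_low] the words met in the recursion are no longer than the tail, so neither bound
    runs out. *)
Lemma act_low_bound n m i w : sorted R w -> (size w <= n)%N -> (size w <= m)%N ->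
  act_low n i w = act_low m i w.
Proof.
elim: n m i w => [|n IHn] m i [|j w] ws wn wm; rewrite ?act_low_nil //.
case: m wm => [//|m] wm.
have ws' : sorted R w by apply: path_sorted ws.
have [ij|ij] := boolP (R i j); first by rewrite !act_low_min.
have E l : act_low n l w = act_low m l w by apply: IHn.
have E' : (fun l => mon_ins l w + act_low n l w) =
          (fun l => mon_ins l w + act_low m l w).
  by apply/funext => l; rewrite E.
rewrite (act_lowS n w ij) (act_lowS m w ij) E' E.
rewrite (malg_lin_eq_low _ (act_low_low m i ws')
  (h' := fun v => mon_ins j v + act_low m j v)) // => v vs vw.
by rewrite (IHn m) //; apply: (leq_trans vw).
Qed.

Lemma rhoU i w : rho i [w] = act i w.
Proof. by rewrite /rho malg_linU scale1r. Qed.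

Lemma act_sort i w : act i (sort R w) = act i w.
Proof.
rewrite /act size_sort (sorted_sort Rtr (sort_sorted Rtot w)).
rewrite /mon_ins; have -> // : sort R (i :: sort R w) = sort R (i :: w).
by apply/(perm_sortP Rtot Rtr Ranti); rewrite perm_cons perm_sort.
Qed.

Lemma sorted_actE i w : sorted R w ->
  act i w = mon_ins i w + act_low (size w) i w.
Proof. by move=> ws; rewrite /act (sorted_sort Rtr ws). Qed.

Lemma rho_min i w : sorted R (i :: w) -> rho i [w] = [i :: w].
Proof.
move=> iws; have ws : sorted R w by apply: path_sorted iws.
rewrite rhoU sorted_actE // /mon_ins (sorted_sort Rtr iws).
case: w iws ws => [|j w]; first by rewrite act_low_nil addr0.
by case/andP=> ij _ _; rewrite act_low_min ?addr0.
Qed.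

Lemma rhoX_linear x : linear (rhoX x).
Proof.
move=> a u v; rewrite /rhoX; apply: malg_lin_lincomb => l.
by rewrite /rho malg_lin_linear.
Qed.

Lemma rhoX_linearl m : linear (rhoX^~ m).
Proof. by move=> a x y; rewrite /rhoX coordL malg_lin_linear. Qed.

Lemma rho_linear i : linear (rho i).
Proof. exact: malg_lin_linear. Qed.

(** The straightening rule i j = j i + [i, j] for j before i, for which [act_low] was designed. *)
Lemma rho_cons i j w : sorted R (j :: w) -> ~~ R i j ->
  rho i [j :: w] = rho j (rho i [w]) + rhoX (br i j) [w].
Proof.
move=> jws ij; have ws : sorted R w by apply: path_sorted jws.
have ji : R j i by have := Rtot i j; rewrite (negbTE ij).
have jall v : all (R j) v -> sorted R v -> sorted R (j :: v).
  by move=> jv vs; rewrite /= path_min_sorted.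
have jw : all (R j) w by apply: order_path_min jws.
rewrite !rhoU (sorted_actE i jws) (sorted_actE i ws) act_lowS // addrA.
rewrite (linD (rho_linear j)).
have sins : sorted R (j :: sort R (i :: w)).
  by apply: jall; rewrite ?sort_sorted // all_sort /= ji.
(* Since j is the least letter, prepending it to the sorted i :: w sorts the whole word. *)
have -> : mon_ins i (j :: w) = rho j (mon_ins i w).
  rewrite [in RHS]/mon_ins (rho_min sins) /mon_ins; congr (<< _ *g _ >>).
  apply: (sorted_eq Rtr Ranti) => //; first exact: sort_sorted.
  by rewrite perm_sort -[j :: _]cat1s -[i :: j :: w]/([:: i] ++ [:: j] ++ w) perm_catCA
     perm_cat2l perm_sym perm_sort.
have E1 : malg_lin (fun v => mon_ins j v + act_low (size w) j v)
    (act_low (size w) i w) = rho j (act_low (size w) i w).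
  apply: malg_lin_eq_low (act_low_low _ i ws) => v vs vw.
  by rewrite sorted_actE // (@act_low_bound (size w) (size v)).
have E2 : (fun l => mon_ins l w + act_low (size w) l w) = (fun l => rho l [w]).
  by apply/funext => l; rewrite rhoU sorted_actE.
by rewrite E1 E2.
Qed.

Lemma rho_low i w : sorted R w ->
  exists2 t, low (size w) t & rho i [w] = mon_ins i w + t.
Proof.
by move=> ws; exists (act_low (size w) i w);
   [apply: act_low_low | rewrite rhoU sorted_actE].
Qed.

Definition rho_rel (i j : g) (m : M) : Prop :=
  rho i (rho j m) - rho j (rho i m) = rhoX (br i j) m.

Lemma rho_rel_submodule i j : is_submodule (rho_rel i j).
Proof.
have L1 := rho_linear i; have L2 := rho_linear j; have LX := rhoX_linear (br i j).
split=> [|a u v]; rewrite /rho_rel.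
  by rewrite !(lin0 L1, lin0 L2, lin0 LX) subrr.
move=> Eu Ev; rewrite !(L1, L2) LX -Eu -Ev scalerBr opprD.
by rewrite addrACA.
Qed.

Lemma rho_rel_sym i j m : rho_rel j i m -> rho_rel i j m.
Proof.
rewrite /rho_rel (lie_anti br_lie i j) => E.
by rewrite (linN (rhoX_linearl m)) /= -E opprB.
Qed.

Lemma rho_rel_min i j w : sorted R (j :: w) -> ~~ R i j -> rho_rel i j [w].
Proof.
by move=> jws ij; rewrite /rho_rel (rho_min jws) rho_cons // addrC addKr.
Qed.

Lemma rho_relX i x m : (forall l, rho_rel i l m) ->
  rho i (rhoX x m) - rhoX x (rho i m) = rhoX (br i x) m.
Proof.
move=> rel; have [[bR bL] _ _] := br_lie; rewrite -{3}[x]coordK.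
rewrite /rhoX; set c := coord x.
have E1 : rho i (malg_lin (fun l => rho l m) c) = malg_lin (fun l => rho i (rho l m)) c.
  rewrite !malg_linE (lin_sum (rho_linear i)); apply: eq_bigr => l _.
  by rewrite (linZ (rho_linear i)).
have E2 : br i (malg_lin id c) = malg_lin (br i) c.
  rewrite !malg_linE (lin_sum (bR i)); apply: eq_bigr => l _.
  by rewrite (linZ (bR i)).
rewrite E1 E2 -[RHS]/(rhoX _ m) !malg_linE (lin_sum (rhoX_linearl m)) -sumrB.
apply: eq_bigr => l _; rewrite /= (linZ (rhoX_linearl m)) /= -rel.
by rewrite scalerBr.
Qed.

(** Induction on the length of words. Up to exchange j precedes i, and if j :: w is sorted the
    relation is [rho_cons]. *)
Lemma rho_rel_low n i j m : low n m -> rho_rel i j m.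
Proof.
elim/ltn_ind: n i j m => n IHn i j m; move: m.
apply: lspan_min; first exact: rho_rel_submodule.
move=> _ [w [ws wn ->]].
wlog ij : i j / ~~ R i j => [H|].
  have [Rij|] := boolP (R i j); last exact: H.
  have [Rji|nRji] := boolP (R j i); last by apply: rho_rel_sym; apply: H.
  have -> : i = j by apply: Ranti; rewrite Rij Rji.
  case: br_lie => _ alt _.
  by rewrite /rho_rel subrr alt (lin0 (rhoX_linearl _)).
have ji : R j i by have := Rtot i j; rewrite (negbTE ij).
have [jws|] := boolP (sorted R (j :: w)); first exact: rho_rel_min.
(* Now l < j < i for the first letter l of the word, and the Jacobi identity for
   i, j, l closes the induction. *)
case: w ws wn => [//|l w] lws wn; rewrite /= [path _ _ _]lws andbT => jl.
have il : ~~ R i l by apply: contraNN jl; apply: Rtr.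
have ws : sorted R w by apply: path_sorted lws.
have lw : all (R l) w by apply: order_path_min lws.
have IH i' j' t : low (size w) t -> rho_rel i' j' t by apply: IHn.
have IHw i' j' : rho_rel i' j' [w] by apply: IH; apply: lowU.
(* [rho j' [w]] is a sorted word with no letter before l, plus terms of length at most [size w]:
   [rho_rel_min] settles the former and induction the latter. *)
have key i' j' : ~~ R i' l -> ~~ R j' l -> rho_rel i' l (rho j' [w]).
  move=> i'l j'l; have [t tlow ->] := rho_low j' ws.
  apply: (submoduleD (rho_rel_submodule _ _)); last exact: IH.
  apply: rho_rel_min => //; rewrite /= path_min_sorted ?sort_sorted //.
  by rewrite all_sort /= lw andbT; have := Rtot j' l; rewrite (negbTE j'l).
have Kij := key i j il jl; have Kji := key j i jl il.
have Xi := rho_relX (br j l) (IHw i); have Xj := rho_relX (br i l) (IHw j).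
have Xl := rho_relX (br i j) (IHw l).
rewrite /rho_rel (rho_cons lws il) (rho_cons lws jl).
rewrite (linD (rho_linear i)) (linD (rho_linear j)).
move: Kij Kji Xi Xj Xl; rewrite /rho_rel.
rewrite (rho_min lws).
move/eqP; rewrite subr_eq => /eqP ->; move/eqP; rewrite subr_eq => /eqP ->.
move/eqP; rewrite subr_eq => /eqP ->; move/eqP; rewrite subr_eq => /eqP ->.
move=> Xl.
(* E is the relation for i, j on the shorter word w, with l applied and moved past [i, j]; J is the
   Jacobi identity. *)
have E : rho l (rho i (rho j [w])) - rho l (rho j (rho i [w])) =
         rhoX (br i j) [l :: w] + rhoX (br l (br i j)) [w].
  by rewrite -(linB (rho_linear l)) IHw -Xl addrC subrK.
have J : rhoX (br l (br i j)) [w] + rhoX (br i (br j l)) [w] -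
    rhoX (br j (br i l)) [w] = 0.
  have [[bR bL] _ jac] := br_lie.
  rewrite (lie_anti br_lie i l) (linN (bR j)) (linN (rhoX_linearl _)) /= opprK.
  by rewrite -!(linD (rhoX_linearl _)) /= jac (lin0 (rhoX_linearl _)).
exact: (telescope6 _ _ E J).
Qed.

Lemma rho_relP i j m : rho_rel i j m.
Proof.
suff H w : rho_rel i j [w].
  have [S0 SP] := rho_rel_submodule i j.
  have -> : m = malg_lin (fun w => [w]) m.
    by apply: (malg_lin_uniq (f := id)) => // a u v.
  exact: malg_lin_submodule.
have E l : rho l [w] = rho l [sort R w] by rewrite !rhoU act_sort.
rewrite /rho_rel !E.
have -> : rhoX (br i j) [w] = rhoX (br i j) [sort R w].
  by rewrite /rhoX (funext E).
by apply: (@rho_rel_low (size w)); apply: lowU; rewrite ?sort_sorted ?size_sort.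
Qed.

Lemma rhoX_br x y m :
  rhoX (br x y) m = rhoX x (rhoX y m) - rhoX y (rhoX x m).
Proof.
have [[bR bL] _ _] := br_lie.
rewrite -{1}[x]coordK {2 3}/rhoX; set c := coord x.
have E1 : br (malg_lin id c) y = malg_lin (br^~ y) c.
  rewrite !malg_linE (lin_sum (bL y)); apply: eq_bigr => l _.
  by rewrite (linZ (bL y)).
rewrite E1 !malg_linE (lin_sum (rhoX_linearl m)) (lin_sum (rhoX_linear y)) -sumrB.
apply: eq_bigr => l _; rewrite (linZ (rhoX_linear y)) /= (linZ (rhoX_linearl m)) /=.
by rewrite -scalerBr -rho_relX // => l'; apply: rho_relP.
Qed.

(** Constant words are sorted, so prepending b creates no correction. *)
Lemma iter_rhoX b n : coord b = << 1 *g b >> ->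
  iter n (rhoX b) [[::]] = [nseq n b].
Proof.
move=> cb; have bb : R b b by have := Rtot b b; rewrite orbb.
elim: n => [//|n IHn]; rewrite iterS IHn /rhoX cb malg_linU scale1r.
rewrite rho_min //=; case: n {IHn} => //= n; rewrite bb /=.
by elim: n => //= n ->; rewrite bb.
Qed.

End PBWModule.

(** Acting on the empty word, b^(n+1) yields the constant word of n+1 letters b; these words are
    distinct, so a linear map can be prescribed on them. *)
Lemma uea_basis_powers (k : fieldType) (g : lmodType k) (br : g -> g -> g) :
  is_lie br -> exists2 B : g -> Prop, forall x, lspan B x &
    forall (C : lmodType k) (F : g -> nat -> C), exists2 h : uea br -> C,
      linear h & forall b n, B b -> h (uea_inj br b ^+ n.+1) = F b n.
Proof.
move=> br_lie.
have [R [coord [Rtot Rtr Ranti [coordL coordK coordB]]]] := ordered_basis g.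
exists (fun b => coord b = << 1 *g b >>) => [x|C F].
  rewrite -[x]coordK.
  apply: (@lspan_min _ _ (fun c => lspan _ (malg_lin id c))) (coordB x).
    have [S0 SD] := lspan_submodule (fun b : g => coord b = << 1 *g b >>).
    by split=> [|a u v Su Sv]; rewrite ?malg_lin0 ?malg_lin_linear //; apply: SD.
  by move=> _ [b cb ->]; rewrite malg_linU scale1r; apply: lspan_gen.
pose M := {malg k[seq g]}; pose e : M := << 1 *g [::] >>.
have nzM : exists v : M, v != 0.
  exists e; apply/eqP => /(congr1 (mcoeff [::])).
  by rewrite mcoeff0 mcoeffUU => /eqP; rewrite oner_eq0.
have [A [app [[appR appL] app1 appM app_inj app_surj]]] := linear_endo_algebra nzM.
have [act actE] := choice (fun x => app_surj _ (rhoX_linear br R coord x)).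
have actL : linear act.
  move=> a x y; apply: app_inj; apply/funext => m; rewrite (appL m) /= !actE.
  exact: (rhoX_linearl br R coordL m a x y).
have actbr x y : act (br x y) = act x * act y - act y * act x.
  apply: app_inj; apply/funext => m.
  rewrite (linB (appL m)) /= !appM !actE.
  exact: (rhoX_br br_lie Rtot Rtr Ranti coordL coordK x y m).
pose phi := uea_lift actL actbr.
(* The first letter and the length minus one recover b and n from a constant word. *)
pose lam := malg_lin (fun w : seq g => if w is b :: s then F b (size s) else 0).
exists (fun u => lam (app (phi u) e)) => [a u v|b n cb].
  by rewrite linearP (appL e) /= /lam malg_lin_linear.
have appX m : app (phi (uea_inj br b) ^+ m) e = iter m (rhoX br R coord b) e.
  by elim: m => [|m IHm]; rewrite ?app1 // exprS appM IHm uea_liftE actE.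
rewrite rmorphXn appX (iter_rhoX br Rtot Rtr _ cb) /lam malg_linU scale1r /=.
by rewrite size_nseq.
Qed.

(** The linear map sending the powers of each basis element b to b is a left inverse. *)
Lemma uea_inj_injective (k : fieldType) (g : lmodType k) (br : g -> g -> g) :
  is_lie br -> injective (uea_inj br).
Proof.
move=> br_lie; have [B Bspan ext] := uea_basis_powers br_lie.
have [h hL hB] := ext g (fun b _ => b).
have iL := uea_linear (ueaP br).
apply: (can_inj (g := h)) => x.
apply: (@lspan_min _ _ (fun x => h (uea_inj br x) = x)) (Bspan x).
  split=> [|a u v Eu Ev]; first by rewrite (lin0 iL) (lin0 hL).
  by rewrite iL hL Eu Ev.
by move=> b Bb; rewrite -[uea_inj _ _]expr1 hB.
Qed.

(** * Restricted Lie and post-Lie algebras *)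

Section LieMorphisms.
Variables (k : fieldType) (L M : lmodType k).
Variables (brL : L -> L -> L) (brM : M -> M -> M) (phi : L -> M).
Hypothesis phiL : linear phi.
Hypothesis phi_br : forall x y, phi (brL x y) = brM (phi x) (phi y).

Lemma iter_br_morph n x y : phi (iter n (brL x) y) = iter n (brM (phi x)) (phi y).
Proof. by elim: n => //= n IHn; rewrite phi_br IHn. Qed.

Lemma jacobson_s_morph p i x y :
  phi (jacobson_s p brL i x y) = jacobson_s p brM i (phi x) (phi y).
Proof.
rewrite /jacobson_s (linZ phiL); congr (_ *: _).
elim: p.-1 i.-1 => [|n IHn] j /=.
  by case: ifP => // _; apply: (lin0 phiL).
rewrite /ad_tD (linD phiL) phi_br IHn; congr (_ + _).
by case: j => [|j]; [apply: (lin0 phiL) | rewrite phi_br IHn].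
Qed.

Lemma restricted_lie_inj p pmL pmM : injective phi ->
  (forall x, phi (pmL x) = pmM (phi x)) ->
  is_restricted_lie p brM pmM -> is_restricted_lie p brL pmL.
Proof.
move=> phiI phi_pm [[[bR bL] alt jac] pmZ pm_ad pmD]; split; first split; first split.
- by move=> x a y z; apply: phiI; rewrite phi_br !phiL bR !phi_br.
- move=> y a x z; apply: phiI; rewrite phi_br !phiL !phi_br.
  exact: (bL (phi y) a (phi x) (phi z)).
- by move=> x; apply: phiI; rewrite phi_br alt (lin0 phiL).
- by move=> x y z; apply: phiI; rewrite !(linD phiL) !phi_br jac (lin0 phiL).
- by move=> a x; apply: phiI; rewrite phi_pm !(linZ phiL) pmZ phi_pm.
- by move=> x y; apply: phiI; rewrite phi_br phi_pm pm_ad iter_br_morph.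
- move=> x y; apply: phiI; rewrite phi_pm !(linD phiL) pmD !phi_pm (lin_sum phiL).
  by congr (_ + _); apply: eq_bigr => i _; rewrite jacobson_s_morph.
Qed.

(** The part of x^[[p]] built from [br] and [rhd] alone, isolated by taking the p-map to be 0. *)
Definition subadj_corr (V : lmodType k) p (br rhd : V -> V -> V) (x : V) : V :=
  subadj_pmap p br (fun _ => 0) rhd x.

Lemma subadj_pmapE (V : lmodType k) p (br rhd : V -> V -> V) pm x :
  subadj_pmap p br pm rhd x = pm x + subadj_corr p br rhd x.
Proof. by rewrite /subadj_corr /subadj_pmap add0r. Qed.

Lemma subadj_corr_morph p rhdL rhdM x :
  (forall y, phi (rhdL x y) = rhdM (phi x) (phi y)) ->
  phi (subadj_corr p brL rhdL x) = subadj_corr p brM rhdM (phi x).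
Proof.
move=> phi_rhd; rewrite /subadj_corr /subadj_pmap !add0r (lin_sum phiL).
apply: eq_bigr => r _; rewrite (linZ phiL) (lin_sum phiL); congr (_ *: _).
apply: eq_bigr => a _; rewrite (linZ phiL); congr (_ *: _).
elim: (map val a) => [|m [|m' b] IHb] /=; first exact: (lin0 phiL).
  by rewrite /rhd_pow; elim: m.-1 => //= n IHn; rewrite phi_rhd IHn.
rewrite phi_br; congr (brM _ _); last exact: IHb.
by rewrite /rhd_pow; elim: m.-1 => //= n IHn; rewrite phi_rhd IHn.
Qed.

End LieMorphisms.

(** * Brackets and spans of iterated p-th powers *)

Section PPowers.
Variables (k : fieldType) (p : nat) (g L C : lmodType k) (br : g -> g -> g).
Hypothesis p0 : (0 < p)%N.
Variables (brL : L -> L -> L) (pmL : L -> L) (brC : C -> C -> C) (pmC : C -> C).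
Hypothesis rL : is_restricted_lie p brL pmL.
Hypothesis rC : is_restricted_lie p brC pmC.
Variables (i : g -> L) (f : g -> C).
Hypothesis iL : linear i.
Hypothesis fL : linear f.
Hypothesis i_br : forall x y, i (br x y) = brL (i x) (i y).
Hypothesis f_br : forall x y, f (br x y) = brC (f x) (f y).

Lemma iter_br_hom (u : L) (v : C) :
  (forall y, exists z, brL u (i y) = i z /\ brC v (f y) = f z) ->
  forall n y, exists z, iter n (brL u) (i y) = i z /\ iter n (brC v) (f y) = f z.
Proof.
move=> H; elim=> [|n IHn] y; first by exists y.
by have [z [/= -> ->]] := IHn y; apply: H.
Qed.

(** The rule ad(x^[p]) = (ad x)^p brings the bracket back to g. L and C are followed together so
    that they share the same z. *)
Lemma ppow_br_hom e x y : exists z,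
  brL (iter e pmL (i x)) (i y) = i z /\ brC (iter e pmC (f x)) (f y) = f z.
Proof.
elim: e x y => [|e IHe] x y; first by exists (br x y).
rewrite !iterS (pmap_ad rL) (pmap_ad rC).
by apply: iter_br_hom => y'; apply: IHe.
Qed.

(** Induction on e: one of the p brackets with the e-th power lands in g by induction, and
    [ppow_br_hom] handles the other p - 1. The case e = 0 is antisymmetry. *)
Lemma ppow_br2_hom e e' x y : exists z,
  brL (iter e pmL (i x)) (iter e' pmL (i y)) = i z /\
  brC (iter e pmC (f x)) (iter e' pmC (f y)) = f z.
Proof.
elim: e => [|e [z [IH1 IH2]]].
  have [z [E1 E2]] := ppow_br_hom e' y x; exists (- z) => /=.
  rewrite (lie_anti (rlie_lie rL)) (lie_anti (rlie_lie rC)) E1 E2.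
  by rewrite (linN iL) (linN fL).
rewrite !iterS (pmap_ad rL) (pmap_ad rC) -(prednK p0) !iterSr IH1 IH2.
by apply: iter_br_hom => y'; apply: ppow_br_hom.
Qed.

End PPowers.

Section PPowerSpan.
Variables (k : fieldType) (p : nat) (g L : lmodType k) (br : g -> g -> g).
Hypothesis p0 : (0 < p)%N.
Variables (brL : L -> L -> L) (pmL : L -> L).
Hypothesis rL : is_restricted_lie p brL pmL.
Variable i : g -> L.
Hypothesis iL : linear i.
Hypothesis i_br : forall x y, i (br x y) = brL (i x) (i y).

Definition ppow (X : g -> Prop) (u : L) : Prop :=
  exists x e, X x /\ u = iter e pmL (i x).

Variable X : g -> Prop.
Hypothesis Xspan : forall x, lspan X x.

Let W := lspan (ppow X).
Let Wsub : is_submodule W. Proof. exact: lspan_submodule. Qed.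

Lemma ppow_span_inj x : W (i x).
Proof.
apply: (@lspan_min _ _ (fun x => W (i x))) (Xspan x).
  split=> [|a u v Wu Wv]; first by rewrite (lin0 iL); apply: submodule0.
  by rewrite iL; case: Wsub => _; apply.
by move=> y Xy; apply: lspan_gen; exists y, 0%N.
Qed.

Lemma im_submodule : is_submodule (fun u => exists z, u = i z).
Proof.
split=> [|a _ _ [z ->] [t ->]]; first by exists 0; rewrite (lin0 iL).
by exists (a *: z + t); rewrite iL.
Qed.

Lemma ppow_span_br u v : W u -> W v -> exists z, brL u v = i z.
Proof.
have [[bR bL] _ _] := rlie_lie rL; have [S0 SP] := im_submodule.
move=> Wu Wv; move: v Wv.
apply: (@lspan_min _ _ (fun v => exists z, brL u v = i z)).
  by split=> [|a v w Ev Ew]; rewrite ?(lin0 (bR u)) ?bR //; apply: SP.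
move=> _ [y [e' [Xy ->]]]; move: u Wu.
apply: (@lspan_min _ _ (fun u => exists z, brL u _ = i z)).
  split=> [|a v w Ev Ew]; first by rewrite (lin0 (bL _)).
  by rewrite (bL _ a v w : brL _ _ = _); apply: SP.
move=> _ [x [e [Xx ->]]].
have [z [-> _]] := ppow_br2_hom p0 rL rL iL iL i_br i_br e e' x y.
by exists z.
Qed.

Lemma ppow_span_pm u : W u -> W (pmL u).
Proof.
have Wbr v w : W v -> W w -> W (brL v w).
  by move=> Wv Ww; have [z ->] := ppow_span_br Wv Ww; apply: ppow_span_inj.
(* The p-map is not additive, so [W u] is carried along: the Jacobson terms of a sum are brackets of
   elements of W. *)
suff H : W u -> W u /\ W (pmL u) by case/H.
apply: (@lspan_min _ _ (fun u => W u /\ W (pmL u))); last first.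
  by move=> _ [x [e [Xx ->]]]; split; apply: lspan_gen; [exists x, e | exists x, e.+1].
have pm0 : pmL 0 = 0 by have := pmapZ rL 0 0; rewrite scale0r expr0n gtn_eqF // scale0r.
have [W0 WP] := Wsub; split=> [|a v w [Wv Wpv] [Ww Wpw]]; first by rewrite pm0.
split; first exact: WP.
rewrite (pmapD rL) (pmapZ rL); apply: (submoduleD Wsub); first exact: WP.
apply: (submodule_sum Wsub) => j _; apply: (submoduleZ Wsub).
have Wav : W (a *: v) by apply: (submoduleZ Wsub).
elim: p.-1 j.-1 => [|n IHn] l /=; first by case: ifP.
rewrite /ad_tD; apply: (submoduleD Wsub); last exact: Wbr.
by case: l => [|l] //; apply: Wbr.
Qed.

End PPowerSpan.

(** * From products on g to products on its p-envelope *)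

Section RestrictedPostLieExtension.
Variables (k : fieldType) (p : nat) (g L C : lmodType k).
Hypothesis p1 : (1 < p)%N.
Variables (brL : L -> L -> L) (pmL : L -> L) (rhdL : L -> L -> L).
Variables (brC : C -> C -> C) (pmC : C -> C) (rhdC : C -> C -> C).
Hypothesis rL : is_restricted_post_lie p brL pmL rhdL.
Hypothesis rC : is_restricted_post_lie p brC pmC rhdC.
Variables (i : g -> L) (h : L -> C).
Hypothesis iL : linear i.
Hypothesis hL : linear h.
Hypothesis h_br : forall u v, h (brL u v) = brC (h u) (h v).
Hypothesis h_pm : forall u, h (pmL u) = pmC (h u).
Hypothesis h_rhd : forall x y, h (rhdL (i x) (i y)) = rhdC (h (i x)) (h (i y)).
Hypothesis br_im : forall u v, exists z, brL u v = i z.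
Hypothesis rhd_im : forall u v, exists z, rhdL u v = i z.
Hypothesis Lspan : forall u, lspan (ppow pmL i (fun=> True)) u.

Let im_sub := im_submodule iL.

(** Terms with r > 1 are brackets; the term r = 1 is an iterated product of u with itself, with at
    least one product because p > 1. *)
Lemma subadj_corr_im u : exists z, subadj_corr p brL rhdL u = i z.
Proof.
rewrite /subadj_corr /subadj_pmap add0r.
apply: (submodule_sum im_sub) => r; rewrite mem_index_iota => /andP[r0 rp].
apply: (submoduleZ im_sub).
rewrite big_mkcond; apply: (submodule_sum im_sub) => a _.
case: ifP => [/andP[_ sum_a]|_]; last exact: (submodule0 im_sub).
apply: (submoduleZ im_sub).
have: size (map val a) = r by rewrite size_map size_tuple.
case: (map val a) sum_a => [|m [|m' b]] /=; first by move=> _ r00; rewrite -r00 in r0.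
  rewrite addn0 => /eqP -> _; rewrite /rhd_pow.
  by case: (p) p1 => [|[|q]] //= _; apply: rhd_im.
by move=> _ _; apply: br_im.
Qed.

(** On the right, p-th powers are handled by y |> x^[p] = (ad_x)^(p-1)(y |> x). On the left, w^[p]
    acts as (w |> -)^p minus the action of the correction term, which lies in the image of [i],
    where compatibility is already known. *)
Lemma rhd_extension u v : h (rhdL u v) = rhdC (h u) (h v).
Proof.
have [LR LL] := plie_bilinear (rplie_plie rL).
have [CR CL] := plie_bilinear (rplie_plie rC).
pose T u := forall v, h (rhdL u v) = rhdC (h u) (h v).
have Tsub : is_submodule T.
  split=> [w|a x y Tx Ty w].
    by rewrite (lin0 (LL w)) (lin0 hL) (lin0 (CL _)).
  rewrite (LL w a x y : rhdL _ _ = _) !hL Tx Ty.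
  by rewrite (CL (h w) a (h x) (h y) : rhdC _ _ = _).
have Tpow u' : (forall y, h (rhdL u' (i y)) = rhdC (h u') (h (i y))) -> T u'.
  move=> Hu w; apply: (@lspan_min _ _ (fun w => h (rhdL u' w) = rhdC (h u') (h w)))
    (Lspan w).
    split=> [|a x y Ex Ey]; first by rewrite (lin0 (LR _)) (lin0 hL) (lin0 (CR _)).
    by rewrite LR !hL CR Ex Ey.
  move=> _ [y [e [_ ->]]]; elim: e => [|e IHe]; first exact: Hu.
  rewrite iterS h_pm (rplie_der rL) (rplie_der rC) -IHe.
  exact: (iter_br_morph h_br).
have Ti x : T (i x) by apply: Tpow => y; apply: h_rhd.
move: v; change (T u); apply: (lspan_min Tsub) (Lspan u) => _ [x [e [_ ->]]].
elim: e => [|e]; first exact: Ti.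
rewrite iterS; move: (iter e pmL (i x)) => w Tw v.
have E := rplie_act rL w v; have E' := rplie_act rC (h w) (h v).
move: E E'; rewrite !subadj_pmapE.
rewrite (linD (LL v)) (linD (CL (h v))) /= => E E'.
rewrite h_pm; apply: (addIr (rhdC (subadj_corr p brC rhdC (h w)) (h v))).
rewrite E' -(subadj_corr_morph hL h_br p Tw).
have [z zE] := subadj_corr_im w.
have <- : h (rhdL (subadj_corr p brL rhdL w) v) =
    rhdC (h (subadj_corr p brL rhdL w)) (h v) by rewrite zE; apply: Ti.
rewrite -(linD hL) E; elim: (p) => //= n IHn.
by rewrite Tw IHn.
Qed.

End RestrictedPostLieExtension.

(** * Primitive elements of U(g) *)

Lemma iter_exp (R : pzRingType) (p e : nat) (u : R) :
  iter e (fun x => x ^+ p) u = u ^+ (p ^ e).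
Proof. by elim: e => [|e IHe]; rewrite ?expr1 //= IHe -exprM expnSr. Qed.

Section Primitive.
Variables (k : fieldType) (p : nat).
Hypothesis charp : p \in [pchar k].
Variables (g : lmodType k) (br : g -> g -> g).
Local Notation U := (uea br).
Local Notation i := (uea_inj br).

Let iL := uea_linear (ueaP br).

Definition primitive (u : U) : Prop :=
  uea_comul br u = tpure u 1 + tpure 1 u.

Lemma gp_lspan (u : U) : u \in uea_gp p (br := br) ->
  lspan (ppow (fun x => x ^+ p) i (fun=> True)) u.
Proof.
move=> /asboolP[s ->].
have sp := lspan_submodule (ppow (fun x => x ^+ p) i (fun=> True)).
elim: s => [|t s IHs]; first by rewrite big_nil; apply: (submodule0 sp).
rewrite big_cons; case: sp => _; apply=> //; apply: lspan_gen.
by exists t.1.2, t.2; rewrite iter_exp.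
Qed.

Lemma lspan_gp (u : U) : lspan (ppow (fun x => x ^+ p) i (fun=> True)) u ->
  u \in uea_gp p (br := br).
Proof.
apply: (@lspan_min _ _ (fun u => u \in uea_gp p (br := br))).
  split=> [|a x y xS yS]; first exact: rpred0.
  by apply: rpredD => //; apply: rpredZ.
move=> _ [x [e [_ ->]]]; apply/asboolP; exists [:: (1, x, e)].
by rewrite big_seq1 scale1r iter_exp.
Qed.

(** The summands of the coproduct of x commute, so Frobenius applies to its p^e-th power. *)
Lemma gp_primitive (u : U) : u \in uea_gp p (br := br) -> primitive u.
Proof.
have [[TR TL] _ _ T1 TM] := tpureP br.
move/gp_lspan; apply: (@lspan_min _ _ primitive).
  split=> [|a x y Px Py]; rewrite /primitive.
    by rewrite linear0 (lin0 (TR 1)) (lin0 (TL 1)) addr0.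
  rewrite TR (TL 1 a x y : tpure _ _ = _) linearP /=.
  by rewrite [uea_comul br x]Px [uea_comul br y]Py scalerDr addrACA.
move=> _ [x [e [_ ->]]]; rewrite iter_exp /primitive rmorphXn /=.
have -> : uea_comul br (i x) = tpure (i x) 1 + tpure 1 (i x) by apply: uea_liftE.
have -> : tpure (i x ^+ (p ^ e)) 1 = tpure (i x) 1 ^+ (p ^ e).
  by elim: (p ^ e)%N => [|n IHn]; rewrite ?T1 // !exprS -IHn TM mulr1.
have -> : tpure 1 (i x ^+ (p ^ e)) = tpure 1 (i x) ^+ (p ^ e).
  by elim: (p ^ e)%N => [|n IHn]; rewrite ?T1 // !exprS -IHn TM mulr1.
have cxy : GRing.comm (tpure (i x) 1) (tpure 1 (i x)).
  by rewrite /GRing.comm !TM !mulr1 !mul1r.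
have charT := pchar_alg (uea2 br) charp.
elim: e => [|e IHe]; first by rewrite !expr1.
rewrite expnSr !exprM IHe.
apply: (pFrobenius_autD_comm charT).
exact/commrX/commr_sym/commrX/commr_sym.
Qed.

(** A bilinear F factors through the tensor product, so the sum depends on the coproduct of u and
    not on the chosen decomposition. *)
Lemma sweedler_primitive (V : lmodType k) (F : U -> U -> V) u :
  is_bilinear F -> primitive u ->
  \sum_(s <- sweedler u) F s.1 s.2 = F u 1 + F 1 u.
Proof.
move=> Fbil Pu; have [h hL hF] := tensor_univ (tpureP br) Fbil.
rewrite -!hF -(linD hL) -Pu sweedlerE (lin_sum hL).
by apply: eq_bigr => s _; rewrite hF.
Qed.

(** * Primitive elements acting by the Guin-Oudom product *)

Section GO.
Variables (rhd : g -> g -> g) (rhdU : U -> U -> U).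
Hypothesis go : is_guin_oudom rhd rhdU.

Let rR := proj1 (go_bilinear go).
Let rL := proj2 (go_bilinear go).

Lemma primitive_der u y z : primitive u ->
  rhdU u (y * z) = rhdU u y * z + y * rhdU u z.
Proof.
move=> Pu; rewrite (go_mul go).
rewrite (sweedler_primitive (F := fun a b => rhdU a y * rhdU b z)) //.
  by rewrite !(go_1l go).
split=> [a c b b'|b c a a'].
  by rewrite (rL z c b b' : rhdU _ _ = _) mulrDr scalerAr.
by rewrite (rL y c a a' : rhdU _ _ = _) mulrDl scalerAl.
Qed.

Lemma primitive_act u y z : primitive u ->
  rhdU u (rhdU y z) = rhdU (u * y + rhdU u y) z.
Proof.
move=> Pu; rewrite (go_rhd go).
rewrite (sweedler_primitive (F := fun a b => a * rhdU b y)) //.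
  by rewrite !(go_1l go) mul1r.
split=> [a c b b'|b c a a'].
  by rewrite (rL y c b b' : rhdU _ _ = _) mulrDr scalerAr.
by rewrite mulrDl scalerAl.
Qed.

Lemma primitive_act_iter u n z : primitive u ->
  rhdU (iter n (fun v => u * v + rhdU u v) 1) z = iter n (rhdU u) z.
Proof.
by move=> Pu; elim: n => [|n IHn] /=; rewrite ?(go_1l go) // -primitive_act // IHn.
Qed.

Let im (u : U) := exists x, u = i x.
Let im_sub : is_submodule im := im_submodule iL.
Let inj_prim x : primitive (i x).
Proof. by apply: gp_primitive; apply: uea_inj_gp. Qed.

Lemma primitive_rhd1 u : primitive u -> rhdU u 1 = 0.
Proof.
move=> Pu; apply: (addrI (rhdU u 1)).
by rewrite addr0 -{3}[1]mulr1 primitive_der // mulr1 mul1r.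
Qed.

(** Induction on the length through (x s) |> y = x |> (s |> y) - (x |> s) |> y, where x |> s is a
    sum of monomials as long as s. *)
Lemma prod_rhd_im (s : seq g) y : im (rhdU (\prod_(x <- s) i x) (i y)).
Proof.
move: {2}(size s) (leqnn (size s)) => n.
elim: n s y => [|n IHn] s y.
  by rewrite leqn0 => /nilP ->; rewrite big_nil (go_1l go); exists y.
case: s => [|x s] /= sn; first by rewrite big_nil (go_1l go); exists y.
rewrite big_cons.
have -> : rhdU (i x * \prod_(z <- s) i z) (i y) =
    rhdU (i x) (rhdU (\prod_(z <- s) i z) (i y)) -
    rhdU (rhdU (i x) (\prod_(z <- s) i z)) (i y).
  by rewrite primitive_act // (linD (rL (i y))) /= addrK.
have [z ->] := IHn s y sn; rewrite (go_ext go).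
apply: (submoduleD im_sub); first by exists (rhd x z).
apply: (submoduleN im_sub).
(* The derivation x |> - passes along the word; s1 is the prefix that it has left behind. *)
suff H s1 s2 : (size s1 + size s2 <= n)%N ->
    im (rhdU (\prod_(z <- s1) i z * rhdU (i x) (\prod_(z <- s2) i z)) (i y)).
  by have := H [::] s sn; rewrite big_nil mul1r.
elim: s2 s1 => [|t s2 IHs] s1 s12.
  rewrite big_nil primitive_rhd1 // mulr0 (lin0 (rL _)).
  exact: (submodule0 im_sub).
rewrite big_cons primitive_der // mulrDr (linD (rL _)) /=.
apply: (submoduleD im_sub); rewrite mulrA.
  rewrite (go_ext go) -mulrA; have := IHn (s1 ++ rhd x t :: s2) y.
  by rewrite big_cat big_cons /=; apply; rewrite size_cat.
have := IHs (rcons s1 t); rewrite -cats1 big_cat big_seq1 /=; apply.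
by rewrite size_cat addn1 addSnnS.
Qed.

Let charU := pchar_alg U charp.
Let rlU := assoc_restricted_lie U charp.
Let i_br x y : i (br x y) = comm (i x) (i y).
Proof. exact: (uea_br (ueaP br)). Qed.
Let p0 := prime_gt0 (pcharf_prime charp).

(** On g, u acts through the monomials x^(p^e). For v a p-power, the derivation D = u |> - satisfies
    D(v^p) = (ad_v)^(p-1)(D v), and bracketing with v preserves g. *)
Lemma gp_rhd_im u v : u \in uea_gp p (br := br) -> v \in uea_gp p (br := br) ->
  im (rhdU u v).
Proof.
have imP := im_sub.
move=> gu gv; have Pu := gp_primitive gu.
have Hu y : im (rhdU u (i y)).
  move: (u) (gp_lspan gu); apply: (@lspan_min _ _ (fun u => im (rhdU u (i y)))).
    split=> [|a w t Ew Et]; first by rewrite (lin0 (rL _)); apply: (submodule0 imP).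
    by rewrite (rL _ a w t : rhdU _ _ = _); case: imP => _; apply.
  move=> _ [x [e [_ ->]]]; rewrite iter_exp.
  have := prod_rhd_im (nseq (p ^ e) x) y.
  rewrite big_nseq; congr (im (rhdU _ _)).
  by elim: (p ^ e)%N => //= n ->; rewrite exprS.
move: (v) (gp_lspan gv); apply: (@lspan_min _ _ (fun v => im (rhdU u v))).
  split=> [|a w t Ew Et]; first by rewrite (lin0 (rR _)); apply: (submodule0 imP).
  by rewrite rR; case: imP => _; apply.
move=> _ [y [e [_ ->]]]; elim: e => [|e [z IHe]]; first exact: Hu.
rewrite iterS (derivation_exp_pchar charU _ (primitive_rhd1 Pu)); last first.
  by move=> *; apply: primitive_der.
rewrite IHe.
have [t [-> _]] := iter_br_hom (ppow_br_hom rlU rlU i_br i_br e y) p.-1 z.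
by exists t.
Qed.

Lemma gp_comm_im u v : u \in uea_gp p (br := br) -> v \in uea_gp p (br := br) ->
  im (comm u v).
Proof.
move=> /gp_lspan gu /gp_lspan gv.
by apply: (ppow_span_br p0 rlU iL i_br gu gv).
Qed.

Lemma gp_exp u : u \in uea_gp p (br := br) -> u ^+ p \in uea_gp p (br := br).
Proof.
move=> /gp_lspan gu; apply: lspan_gp.
apply: (ppow_span_pm p0 rlU iL i_br _ gu).
by move=> x; apply: lspan_gen.
Qed.

End GO.
End Primitive.

(** * The universal p-envelope *)

Section Envelope.
Variables (k : fieldType) (p : nat).
Hypothesis charp : p \in [pchar k].
Variables (g : lmodType k) (br rhd : g -> g -> g).
Hypothesis g_post_lie : is_post_lie br rhd.
Local Notation U := (uea br).
Local Notation i := (uea_inj br).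
Local Notation G := (gp p br).
Variable rhdU : U -> U -> U.
Hypothesis go : is_guin_oudom rhd rhdU.

Let p0 := prime_gt0 (pcharf_prime charp).
Let p1 := prime_gt1 (pcharf_prime charp).
Let charU := pchar_alg U charp.
Let rR := proj1 (go_bilinear go).
Let rL := proj2 (go_bilinear go).

Let gp_valP (a : G) : gp_val a \in uea_gp p (br := br).
Proof. exact: valP. Qed.
Let gp_val_inj : injective (@gp_val _ p _ br).
Proof. exact: val_inj. Qed.
Let gp_val_linear : linear (@gp_val _ p _ br).
Proof. by move=> a x y. Qed.
Let gp_val_prim (a : G) : primitive (gp_val a).
Proof. exact: (gp_primitive charp). Qed.

Fact gp_br_subproof (a b : G) : comm (gp_val a) (gp_val b) \in uea_gp p (br := br).
Proof.
have [x ->] := gp_comm_im charp (gp_valP a) (gp_valP b); exact: uea_inj_gp.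
Qed.
Definition gp_br (a b : G) : G := GP (gp_br_subproof a b).

Definition gp_pm (a : G) : G := GP (gp_exp charp (gp_valP a)).

Fact gp_rhd_subproof (a b : G) : rhdU (gp_val a) (gp_val b) \in uea_gp p (br := br).
Proof.
have [x ->] := gp_rhd_im charp go (gp_valP a) (gp_valP b); exact: uea_inj_gp.
Qed.
Definition gp_rhd (a b : G) : G := GP (gp_rhd_subproof a b).

Let jL : linear (gp_inj p br).
Proof. by move=> a x y; apply: gp_val_inj => /=; rewrite (uea_linear (ueaP br)). Qed.

Let j_br x y : gp_inj p br (br x y) = gp_br (gp_inj p br x) (gp_inj p br y).
Proof. by apply: gp_val_inj; rewrite /= (uea_br (ueaP br)). Qed.

Lemma gp_restricted_lie : is_restricted_lie p gp_br gp_pm.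
Proof.
apply: (restricted_lie_inj gp_val_linear _ gp_val_inj _ (assoc_restricted_lie U charp)).
  by [].
by [].
Qed.

Lemma gp_post_lie : is_post_lie gp_br gp_rhd.
Proof.
split; first exact: (rlie_lie gp_restricted_lie).
- split=> [a c x y|a c x y]; apply: gp_val_inj; rewrite /=; first exact: rR.
  exact: (rL (gp_val a) c (gp_val x) (gp_val y)).
- move=> x y z; apply: gp_val_inj; rewrite /= /comm (linB (rR _)).
  rewrite !(primitive_der go _ _ (gp_val_prim x)) opprD [RHS]addrACA.
  by congr (_ + _); rewrite addrC.
move=> x y z; apply: gp_val_inj; rewrite /= /comm.
rewrite !(primitive_act go) // -(linB (rL _)) /=; congr (rhdU _ _).
by rewrite opprD addrACA addrA.
Qed.

Lemma gp_restricted_post_lie : is_restricted_post_lie p gp_br gp_pm gp_rhd.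
Proof.
split; [exact: gp_post_lie | exact: gp_restricted_lie | |].
  move=> x y; apply: gp_val_inj.
  rewrite (iter_br_morph (phi := @gp_val _ p _ br) (brM := @comm U)) //=.
  apply: (derivation_exp_pchar charU).
    exact: (primitive_rhd1 go).
  by move=> u v; apply: (primitive_der go).
move=> x y; apply: gp_val_inj.
have -> n : gp_val (iter n (gp_rhd x) y) = iter n (rhdU (gp_val x)) (gp_val y).
  by elim: n => //= n ->.
(* The p-fold action of x is that of (L_x + D)^p 1, which is x^[[p]] computed in U(g). *)
rewrite -(primitive_act_iter go) // (subadj_pmap_assoc charp).
- rewrite !subadj_pmapE /=; congr (rhdU (_ + _) _).
  exact: (subadj_corr_morph gp_val_linear).
- exact: (linD (rR _)).
- by move=> u v; apply: (primitive_der go).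
Qed.

Let iter_gp_pm e x : gp_val (iter e gp_pm x) = gp_val x ^+ (p ^ e).
Proof. by rewrite -iter_exp; elim: e => //= e ->. Qed.

Lemma gp_span (u : G) : lspan (ppow gp_pm (gp_inj p br) (fun=> True)) u.
Proof.
have sp := lspan_submodule (ppow gp_pm (gp_inj p br) (fun=> True)).
have /asboolP[s us] := gp_valP u.
have -> : u = \sum_(t <- s) t.1.1 *: iter t.2 gp_pm (gp_inj p br t.1.2).
  apply: gp_val_inj; rewrite us (lin_sum gp_val_linear); apply: eq_bigr => t _.
  by rewrite (linZ gp_val_linear) iter_gp_pm.
apply: (submodule_sum sp) => t _; apply: (submoduleZ sp); apply: lspan_gen.
by exists t.1.2, t.2.
Qed.

(** The span of the b^(p^e) contains g and is closed under the p-map, hence contains every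
    x^(p^e). *)
Lemma gp_span_basis (B : g -> Prop) : (forall x, lspan B x) ->
  forall u, lspan (ppow gp_pm (gp_inj p br) B) u.
Proof.
move=> Bspan u; apply: lspan_min (gp_span u); first exact: lspan_submodule.
move=> _ [x [e [_ ->]]]; elim: e => [|e IHe].
  exact: (ppow_span_inj gp_pm jL Bspan).
exact: (ppow_span_pm p0 gp_restricted_lie jL j_br Bspan).
Qed.

Lemma gp_p_envelope :
  is_p_envelope p br rhd gp_br gp_pm gp_rhd (gp_inj p br).
Proof.
split; first exact: gp_restricted_post_lie.
- split=> // x y; apply: gp_val_inj.
  by rewrite /= (go_ext go).
- move=> x y /(congr1 (@gp_val _ p _ br)); apply: uea_inj_injective.
  exact: (plie_lie g_post_lie).
move=> u S [S0 SP _ _ Spm] Sg.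
apply: (@lspan_min _ _ S) (gp_span u); first by split.
by move=> _ [x [e [_ ->]]]; elim: e => [|e IHe]; [apply: Sg; exists x | apply: Spm].
Qed.

Lemma gp_universal : is_universal_p_envelope p br rhd gp_br gp_pm gp_rhd (gp_inj p br).
Proof.
split; first exact: gp_p_envelope.
move=> C brC pmC rhdC rC f [fL f_br f_rhd].
have rlC := rplie_rlie rC; have rlG := gp_restricted_lie.
have [B Bspan ext] := uea_basis_powers (plie_lie g_post_lie).
(* At n + 1 = p^e the logarithm is e, so b^(p^e) goes to the e-th iterate of the p-map at f(b). The
   values at other exponents are free, as g^(p) is spanned by the b^(p^e). *)
have [hU hUL hUB] := ext C (fun b n => iter (logn p n.+1) pmC (f b)).
pose h (u : G) := hU (gp_val u).
have hL : linear h by move=> a u v; rewrite /h gp_val_linear hUL.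
have hB b e : B b -> h (iter e gp_pm (gp_inj p br b)) = iter e pmC (f b).
  move=> Bb; rewrite /h iter_gp_pm /= -[(p ^ e)%N]prednK ?expn_gt0 ?p0 // hUB //.
  by rewrite prednK ?expn_gt0 ?p0 // pfactorK // (pcharf_prime charp).
have hf x : h (gp_inj p br x) = f x.
  apply: (@lspan_min _ _ (fun x => h (gp_inj p br x) = f x)) (Bspan x).
    split=> [|a u v Eu Ev]; first by rewrite (lin0 jL) (lin0 hL) (lin0 fL).
    by rewrite jL hL fL Eu Ev.
  by move=> b Bb; apply: (hB b 0%N).
have spB := gp_span_basis Bspan.
have [[GbR GbL] _ _] := rlie_lie rlG; have [[CbR CbL] _ _] := rlie_lie rlC.
(* By bilinearity it suffices to treat powers of basis elements, whose brackets in both algebras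
   come from one z in g. *)
have h_br u v : h (gp_br u v) = brC (h u) (h v).
  move: v (spB v); apply: (@lspan_min _ _ (fun v => h (gp_br u v) = brC (h u) (h v))).
    split=> [|a x y Ex Ey]; first by rewrite (lin0 (GbR _)) (lin0 hL) (lin0 (CbR _)).
    by rewrite GbR !hL CbR Ex Ey.
  move=> _ [y [e' [By ->]]]; set v := iter e' _ _.
  move: u (spB u); apply: (@lspan_min _ _ (fun u => h (gp_br u v) = brC (h u) (h v))).
    split=> [|a x z Ex Ez]; first by rewrite (lin0 (GbL _)) (lin0 hL) (lin0 (CbL _)).
    rewrite (GbL v a x z : gp_br _ _ = _) !hL Ex Ez.
    by rewrite (CbL (h v) a (h x) (h z) : brC _ _ = _).
  move=> _ [x [e [Bx ->]]]; rewrite /v !hB //.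
  have [z [-> ->]] := ppow_br2_hom p0 rlG rlC jL fL j_br f_br e e' x y.
  exact: hf.
(* Jacobson's formula holds on both sides and h preserves brackets, so agreement passes from the
   b^(p^e) to their span. *)
have h_pm u : h (gp_pm u) = pmC (h u).
  move: u (spB u); apply: (@lspan_min _ _ (fun u => h (gp_pm u) = pmC (h u))).
    have pm0 (V : lmodType k) (b : V -> V -> V) pm :
        is_restricted_lie p b pm -> pm 0 = 0.
      by move=> rV; have := pmapZ rV 0 0; rewrite scale0r expr0n gtn_eqF // scale0r.
    split=> [|a x y Ex Ey]; first by rewrite (pm0 _ _ _ rlG) (lin0 hL) (pm0 _ _ _ rlC).
    rewrite (pmapD rlG) (pmapZ rlG) hL (pmapD rlC) (pmapZ rlC).
    rewrite !(linD hL) (linZ hL) Ex Ey (lin_sum hL); congr (_ + _).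
    apply: eq_bigr => j _; rewrite (jacobson_s_morph hL h_br).
    by rewrite (linZ hL).
  by move=> _ [b [e [Bb ->]]]; rewrite -iterS !hB.
have h_rhd u v : h (gp_rhd u v) = rhdC (h u) (h v).
  apply: (rhd_extension p1 gp_restricted_post_lie rC jL hL h_br h_pm) => //.
  - move=> x y; rewrite !hf -f_rhd -hf; congr h; apply: gp_val_inj.
    by rewrite /= (go_ext go).
  - move=> a b; have [z E] := gp_comm_im charp (gp_valP a) (gp_valP b).
    by exists z; apply: gp_val_inj.
  - move=> a b; have [z E] := gp_rhd_im charp go (gp_valP a) (gp_valP b).
    by exists z; apply: gp_val_inj.
  exact: gp_span.
exists h; split; first by split=> //; split=> //; split.
(* Uniqueness: preserving the p-map forces the values on all x^(p^e), which span. *)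
move=> h' [[[h'L _ _] h'_pm] h'f]; apply/funext => u.
apply: (@lspan_min _ _ (fun u => h u = h' u)) (gp_span u).
  split=> [|a x y Ex Ey]; first by rewrite (lin0 hL) (lin0 h'L).
  by rewrite hL h'L Ex Ey.
move=> _ [x [e [_ ->]]]; elim: e => [|e IHe]; first by rewrite hf -h'f.
by rewrite iterS h_pm h'_pm IHe.
Qed.

End Envelope.

Theorem theorem3p7 (k : closedFieldType) (p : nat) (charkp : p \in [pchar k])
    (g : lmodType k) (br rhd : g -> g -> g) (g_post_lie : is_post_lie br rhd)
    (rhdU : uea br -> uea br -> uea br) (rhdU_go : is_guin_oudom rhd rhdU) :
  exists (brP : gp p br -> gp p br -> gp p br) (pmP : gp p br -> gp p br)
         (rhdP : gp p br -> gp p br -> gp p br),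
    [/\ (forall a b,
           gp_val (brP a b) = gp_val a * gp_val b - gp_val b * gp_val a),
        (forall a, gp_val (pmP a) = gp_val a ^+ p),
        (forall a b, gp_val (rhdP a b) = rhdU (gp_val a) (gp_val b)) &
        is_universal_p_envelope p br rhd brP pmP rhdP (gp_inj p br)].
Proof.
exists (@gp_br _ _ charkp _ br), (@gp_pm _ _ charkp _ br), (gp_rhd charkp rhdU_go).
split=> //; exact: gp_universal.
Qed.
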